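(* Let $p(z)$ be a polynomial of degree $k\geq 1$ and let $\beta$ be an entire function that is a small function of $e^{p(z)}$. Let $$H(z)=e^{p(z)}\int_0^{z}\beta(t)e^{-p(t)}\,dt .$$ Let $\delta(p,\theta)$, the sectors $S_j$ ($j=1,\dots,2k$), their closures $\overline{S}_j$, and the closed subsectors $\overline{S}_{j,\epsilon}$ be as defined in the context. Then: (i) for each $S_j$ on which $\delta(p,\theta)>0$, there is a constant $a_j$ such that, for every $\epsilon>0$, $|H(re^{i\theta})-a_je^{p(re^{i\theta})}|\leq e^{o(1)r^{k}}$ uniformly as $r\to\infty$ in $\overline{S}_{j,\epsilon}$; (ii) for each $S_j$ on which $\delta(p,\theta)<0$, $|H(re^{i\theta})-ae^{p(re^{i\theta})}|\leq e^{o(1)r^{k}}$ uniformly as $r\to\infty$ in $\overline{S}_{j}$ for any constant $a$.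
   Context: Small function: a meromorphic function $\gamma\not\equiv\infty$ in $\mathbb{C}$ is a small function of a meromorphic function $f$ if $T(r,\gamma)=S(r,f)$, where $T$ is the Nevanlinna characteristic and $S(r,f)$ denotes any quantity satisfying $S(r,f)=o(T(r,f))$ as $r\to\infty$, possibly outside an exceptional set of finite linear measure. Write $p(z)=\alpha z^{k}+p_{k-1}(z)$, where $\alpha=a_0+ib_0\neq 0$ with $a_0,b_0$ real and $p_{k-1}$ is a polynomial of degree at most $k-1$. Set $\delta(p,\theta)=a_0\cos k\theta-b_0\sin k\theta$ for real $\theta$. Let $\theta_1<\theta_2<\cdots<\theta_{2k}$ be the zeros of $\delta(p,\cdot)$ in $[0,2\pi)$ (so $\theta_j=\theta_1+(j-1)\pi/k$), and put $\theta_{2k+1}=\theta_1+2\pi$. For $j=1,\dots,2k$ define $$S_j=\{re^{i\theta}: 0\leq r<\infty,\ \theta_j<\theta<\theta_{j+1}\},$$ let $\overline{S}_j$ be the closure of $S_j$, and for $\epsilon>0$ let $$\overline{S}_{j,\epsilon}=\{re^{i\theta}: 0\leq r<\infty,\ \theta_j+\epsilon\leq\theta\leq\theta_{j+1}-\epsilon\}.$$ On each $S_j$ the function $\delta(p,\theta)$ has constant sign. The bound ''$\leq e^{o(1)r^k}$ uniformly as $r\to\infty$ in a sector'' means: for every $\eta>0$ there is $r_0$ such that the bound with $e^{\eta r^k}$ on the right-hand side holds for all points $re^{i\theta}$ of the sector with $r\geq r_0$. *)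

(* Defs.v *)
From HB Require Import structures.
From mathcomp Require Import all_boot all_order all_algebra.
From mathcomp Require Import complex.
From mathcomp Require Import all_classical all_reals all_analysis.

Set Implicit Arguments.
Unset Strict Implicit.
Unset Printing Implicit Defensive.

Import Order.TTheory GRing.Theory Num.Theory.
Import numFieldNormedType.Exports.

Local Open Scope classical_set_scope.
Local Open Scope ring_scope.
Local Open Scope complex_scope.

(* [R[i]^o] rather than [R[i]]: the regular module carries the normed-space
   topology in which [closure], [derivable] and [_^'] are taken. *)
Notation Cplx R := (complex R)^o.

Section Complex.
Context {R : realType}.
Implicit Types (f : Cplx R -> Cplx R) (z : Cplx R).

(* The modulus as an element of [R]; the library norm on [R[i]] is [R[i]]-valued. *)
Definition cmod z : R := complex.Re `|z|.

Definition polar (r theta : R) : Cplx R :=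
  (r * cos theta) +i* (r * sin theta).

Definition cexp z : Cplx R := polar (expR (complex.Re z)) (complex.Im z).

Definition entire f : Prop := forall z, derivable f z 1.

(* The integral of [f] from [0] to [z] along the segment [t |-> t z], 0 <= t <= 1.
   For entire [f] it does not depend on the path. *)
Definition cint0 f z : Cplx R :=
  z * ((\int[lebesgue_measure]_(t in `[0, 1]) complex.Re (f (t%:C * z))) +i*
       (\int[lebesgue_measure]_(t in `[0, 1]) complex.Im (f (t%:C * z)))).

End Complex.

(* A meromorphic function is represented by a total function on [C] whose values
   at its poles are arbitrary. *)
Section Nevanlinna.
Context {R : realType}.
Implicit Types (f g : Cplx R -> Cplx R) (z : Cplx R) (r t : R).

(* [ln] vanishes on nonpositive arguments, so [logp 0 = 0]. *)
Definition logp (x : R) : R := Num.max 0 (ln x).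

Definition proximity f r : R :=
  (2 * pi)^-1 *
  \int[lebesgue_measure]_(theta in `[0, 2 * pi]) logp (cmod (f (polar r theta))).

Definition pole_bounded f z (n : nat) : Prop :=
  exists M : R, \forall w \near z^', cmod ((w - z) ^+ n * f w) <= M.

(* The multiplicity of [z] as a pole of [f]: the least [n] for which
   [(w - z)^n f(w)] is bounded near [z]; it is 0 when [f] is holomorphic at [z]. *)
Definition pole_order f z : nat :=
  xget 0%N [set n | pole_bounded f z n /\
                    forall m, pole_bounded f z m -> (n <= m)%N].

Definition pole_count f t : nat :=
  (\sum_(z \in [set z : Cplx R | (cmod z <= t)%R]) pole_order f z)%N.

Definition counting_fun f r : R :=
  \int[lebesgue_measure]_(t in `[0, r])
     (((pole_count f t)%:R - (pole_count f 0)%:R) / t)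
  + (pole_count f 0)%:R * ln r.

Definition characteristic f r : R := proximity f r + counting_fun f r.

(* [u r = S(r, f)]. *)
Definition is_Srf f (u : R -> R) : Prop :=
  exists E : set R,
    [/\ measurable E, (lebesgue_measure E < +oo)%E &
        forall eta : R, 0 < eta ->
          exists r0 : R, forall r, r0 <= r -> ~ E r ->
            `|u r| <= eta * `|characteristic f r| ].

Definition small_function g f : Prop := is_Srf f (characteristic g).

End Nevanlinna.

Section Sectors.
Context {R : realType}.
Implicit Types (p : {poly R[i]}) (theta : R) (th : nat -> R) (j : nat).

Definition delta p theta : R :=
  let k := (size p).-1 in
  complex.Re (lead_coef p) * cos (k%:R * theta)
  - complex.Im (lead_coef p) * sin (k%:R * theta).

(* [th 1 < ... < th (2 k)] are exactly the zeros of [delta p] in [0, 2 pi), and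
   [th (2 k + 1) = th 1 + 2 pi]; the other values of [th] are irrelevant. *)
Definition critical_angles p th : Prop :=
  let k := (size p).-1 in
  [/\ forall i j, (1 <= i)%N -> (i < j)%N -> (j <= 2 * k)%N -> th i < th j,
      forall theta, (exists j, (1 <= j <= 2 * k)%N /\ th j = theta) <->
                    (0 <= theta < 2 * pi /\ delta p theta = 0) &
      th (2 * k).+1 = th 1%N + 2 * pi].

Definition sector th j : set (Cplx R) :=
  [set z | exists r theta,
     [/\ 0 <= r, th j < theta < th j.+1 & z = polar r theta]].

Definition subsector th j (eps : R) : set (Cplx R) :=
  [set z | exists r theta,
     [/\ 0 <= r, th j + eps <= theta <= th j.+1 - eps & z = polar r theta]].

(* [g z <= e^(o(1) r^k)] uniformly as [r = |z|] tends to infinity in [D]. *)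
Definition le_exp_o (k : nat) (D : set (Cplx R)) (g : Cplx R -> R) : Prop :=
  forall eta : R, 0 < eta ->
    exists r0 : R, forall z, D z -> r0 <= cmod z ->
      g z <= expR (eta * cmod z ^+ k).

Definition Hfun p (beta : Cplx R -> Cplx R) (z : Cplx R) : Cplx R :=
  cexp p.[z] * cint0 (fun t => beta t * cexp (- p.[t])) z.

End Sectors.

(* Main.v *)
(* The growth of [beta]: [T(r, exp p) = O(r^k)], so [T(r, beta) = o(r^k)] off a set
   of finite measure. Bounding [log |beta|] on [|z| = r] by a multiple of
   [T(s, beta)] for some [s] in [[2 r, 3 r]] outside that set removes the
   exception: [|beta z| <= exp (o(1) |z|^k)] everywhere.

   Put [F = cint0 (beta exp (- p))], so that [H = exp p * F]. Where [delta <= 0],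
   [Re p z - Re p (t z) <= o(1) |z|^k] for [0 <= t <= 1], and integrating along the
   segment from 0 bounds [H]. Where [delta > 0], [F'] decays exponentially along
   rays, so [F] has a limit [a] at infinity; it is the same on all rays of a
   sector because the integral of [F'] over an arc of radius [s] tends to 0, and
   [exp p * (F - a)] is bounded by integrating along the ray from [z] to
   infinity.

   All the complex analysis needed follows from the existence of primitives. *)

(* Integrals are handled as increments of primitives, and estimated by a mean value inequality
   comparing a complex curve with a real majorant. Thus a primitive of [K (z + exp w)] gives the
   mean value property, and the maximum principle follows without Cauchy's formula or power series.

   The hypothesis on [beta] bounds only a circular average of log+ |beta|, and only off an
   exceptional set. The average becomes a pointwise bound by applying the maximum principle to
   [f exp (- P)], where the entire function [P] has a real part dominating log+ |f| on the circle.

   Case (ii) reaches the closed sector because its only sign condition, Re (lead z^k) <= 0, is a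
   closed one. Case (i) needs [delta >= c > 0] for the integrals to converge at a definite rate, and
   compactness gives such a [c] only on closed subsectors.

   An exponent of the form 3 e r^k collects three errors: one for [beta] and one for each of the two
   places where [p] is replaced by its leading term. The condition 8 e <= c keeps these errors below
   half of the decay rate. *)
Require Import Defs.
From mathcomp Require Import all_boot all_order all_algebra.
From mathcomp Require Import complex.
From mathcomp Require Import all_classical all_reals all_analysis.
From mathcomp Require Import ring lra.
Import Order.TTheory GRing.Theory Num.Theory.
Import numFieldNormedType.Exports.
Local Open Scope classical_set_scope.
Local Open Scope ring_scope.
Local Open Scope complex_scope.

(** * The complex plane over a real field *)

Section Modulus.
Context {R : realType}.
Implicit Types (z w : R[i]) (x y : R).

Lemma cmodE z : cmod z = Num.sqrt (complex.Re z ^+ 2 + complex.Im z ^+ 2).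
Proof. by rewrite /cmod normc_def. Qed.

Lemma cmod_ge0 z : 0 <= cmod z.
Proof. by rewrite cmodE sqrtr_ge0. Qed.

Lemma norm_cmod z : `|z| = (cmod z)%:C.
Proof. by rewrite cmodE normc_def. Qed.

Lemma sqr_cmod z : cmod z ^+ 2 = complex.Re z ^+ 2 + complex.Im z ^+ 2.
Proof. by rewrite cmodE sqr_sqrtr // addr_ge0 // sqr_ge0. Qed.

Lemma cmod0 : cmod (0 : R[i]) = 0.
Proof. by rewrite /cmod normr0. Qed.

Lemma cmod1 : cmod (1 : R[i]) = 1.
Proof. by rewrite /cmod normr1. Qed.

Lemma cmod_eq0 z : (cmod z == 0) = (z == 0).
Proof.
by rewrite -[RHS]normr_eq0 norm_cmod (inj_eq (@complexI R)).
Qed.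

Lemma cmod_gt0 z : (0 < cmod z) = (z != 0).
Proof. by rewrite lt0r cmod_eq0 cmod_ge0 andbT. Qed.

Lemma cmodM z w : cmod (z * w) = cmod z * cmod w.
Proof. by apply: (@complexI R); rewrite rmorphM/= -!norm_cmod normrM. Qed.

Lemma cmodN z : cmod (- z) = cmod z.
Proof. by rewrite /cmod normrN. Qed.

Lemma cmodBC z w : cmod (z - w) = cmod (w - z).
Proof. by rewrite -cmodN opprB. Qed.

Lemma cmodX z n : cmod (z ^+ n) = cmod z ^+ n.
Proof. by elim: n => [|n IH]; rewrite ?expr0 ?cmod1// !exprS cmodM IH. Qed.

Lemma cmodV z : cmod z^-1 = (cmod z)^-1.
Proof.
have [->|z0] := eqVneq z 0; first by rewrite invr0 cmod0 invr0.
apply: (mulfI (_ : cmod z != 0)); first by rewrite cmod_eq0.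
by rewrite -cmodM !mulfV ?cmod1// cmod_eq0.
Qed.

Lemma le_cmodD z w : cmod (z + w) <= cmod z + cmod w.
Proof. by rewrite -lecR rmorphD/= -!norm_cmod ler_normD. Qed.

Lemma le_cmodB z w : cmod (z - w) <= cmod z + cmod w.
Proof. by rewrite (le_trans (le_cmodD _ _))// cmodN. Qed.

Lemma ge_cmodB z w : cmod z - cmod w <= cmod (z - w).
Proof. by rewrite lerBlDr -{1}(subrK w z) le_cmodD. Qed.

Lemma cmod_real x : cmod x%:C = `|x|.
Proof. by rewrite cmodE/= expr0n addr0 sqrtr_sqr. Qed.

Lemma cmod_i : cmod ('i%C : R[i]) = 1.
Proof. by rewrite cmodE/= expr0n add0r expr1n sqrtr1. Qed.

Lemma Re_le_cmod z : `|complex.Re z| <= cmod z.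
Proof.
by rewrite cmodE -sqrtr_sqr ler_wsqrtr// lerDl sqr_ge0.
Qed.

Lemma Im_le_cmod z : `|complex.Im z| <= cmod z.
Proof.
by rewrite cmodE -[X in X <= _]sqrtr_sqr ler_wsqrtr// lerDr sqr_ge0.
Qed.

Lemma ler_Re_cmod z : complex.Re z <= cmod z.
Proof. exact: le_trans (ler_norm _) (Re_le_cmod z). Qed.

Lemma le_cmod_ReIm z : cmod z <= `|complex.Re z| + `|complex.Im z|.
Proof.
rewrite {1}[z]complexE.
by rewrite (le_trans (le_cmodD _ _))// cmodM cmod_i mul1r !cmod_real.
Qed.

Lemma cmod_sum (I : Type) (r : seq I) (P : pred I) (F : I -> R[i]) :
  cmod (\sum_(i <- r | P i) F i) <= \sum_(i <- r | P i) cmod (F i).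
Proof.
elim/big_rec2 : _ => [|i y x _ IH]; first by rewrite cmod0.
by rewrite (le_trans (le_cmodD _ _))// lerD2l.
Qed.

Lemma cReD z w : complex.Re (z + w) = complex.Re z + complex.Re w.
Proof. by case: z; case: w. Qed.

Lemma cReB z w : complex.Re (z - w) = complex.Re z - complex.Re w.
Proof. by case: z; case: w. Qed.

Lemma cImD z w : complex.Im (z + w) = complex.Im z + complex.Im w.
Proof. by case: z; case: w. Qed.

Lemma cImB z w : complex.Im (z - w) = complex.Im z - complex.Im w.
Proof. by case: z; case: w. Qed.

Lemma cReN z : complex.Re (- z) = - complex.Re z.
Proof. by case: z. Qed.

Lemma cReM z w : complex.Re (z * w) =
  complex.Re z * complex.Re w - complex.Im z * complex.Im w.
Proof. by case: z; case: w. Qed.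

Lemma cImM z w : complex.Im (z * w) =
  complex.Re z * complex.Im w + complex.Im z * complex.Re w.
Proof. by case: z => a b; case: w => c d /=; rewrite (mulrC b). Qed.

Lemma cReZ x z : complex.Re (x%:C * z) = x * complex.Re z.
Proof. by rewrite cReM/= mul0r subr0. Qed.

Lemma cImZ x z : complex.Im (x%:C * z) = x * complex.Im z.
Proof. by rewrite cImM/= mul0r addr0. Qed.

Lemma cRe_sum (I : Type) (r : seq I) (P : pred I) (F : I -> R[i]) :
  complex.Re (\sum_(i <- r | P i) F i) = \sum_(i <- r | P i) complex.Re (F i).
Proof. by elim/big_rec2 : _ => // i y x _ <-; rewrite cReD. Qed.

(* The unit vector [c] rotates [w] onto its modulus. *)
Lemma unit_rotation w : exists c : R[i], cmod c = 1 /\ complex.Re (c * w) = cmod w.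
Proof.
have [->|w0] := eqVneq w 0; first by exists 1; rewrite mulr0 cmod1 cmod0.
exists ((cmod w)%:C / w); split.
  by rewrite cmodM cmodV cmod_real ger0_norm ?cmod_ge0// divff// cmod_eq0.
by rewrite -mulrA mulVf// mulr1.
Qed.

End Modulus.

(** * Polar coordinates and the complex exponential *)

Section PolarExp.
Context {R : realType}.
Implicit Types (z w : R[i]) (r t : R).

Lemma polarD r s t u : polar (r * s) (t + u) = polar r t * polar s u :> R[i].
Proof.
apply/eqP; rewrite eq_complex cReM cImM/= cosD sinD.
by apply/andP; split; apply/eqP; ring.
Qed.

Lemma cmod_polar r t : 0 <= r -> cmod (polar r t) = r.
Proof.
move=> r0; rewrite cmodE/= !exprMn -mulrDr cos2Dsin2 mulr1.
by rewrite sqrtr_sqr ger0_norm.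
Qed.

Lemma polarX r t n : polar r t ^+ n = polar (r ^+ n) (n%:R * t) :> R[i].
Proof.
elim: n => [|n IH].
  by rewrite !expr0 mul0r; apply/eqP; rewrite eq_complex/= cos0 sin0 mulr1 mulr0 !eqxx.
by rewrite !exprS IH -polarD -natr1 mulrDl mul1r [t + _]addrC.
Qed.

Lemma polarZ r t : polar r t = r%:C * polar 1 t :> R[i].
Proof. by apply/eqP; rewrite eq_complex cReZ cImZ/= !mul1r !eqxx. Qed.

Lemma cexpD z w : cexp (z + w) = cexp z * cexp w :> R[i].
Proof. by rewrite /cexp cReD cImD expRD polarD. Qed.

Lemma cexp0 : cexp 0 = 1 :> R[i].
Proof.
by apply/eqP; rewrite eq_complex/= expR0 cos0 sin0 mulr1 mulr0 !eqxx.
Qed.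

Lemma cmod_cexp z : cmod (cexp z) = expR (complex.Re z).
Proof. by rewrite cmod_polar// expR_ge0. Qed.

Lemma cexp_polar r t : 0 < r -> cexp (ln r +i* t) = polar r t :> R[i].
Proof. by move=> r0; rewrite /cexp/= lnK. Qed.

Lemma polar_surj z : exists t, 0 <= t <= 2 * pi /\ z = polar (cmod z) t.
Proof.
have [->|z0] := eqVneq z 0.
  exists 0; rewrite lexx mulr_ge0 ?pi_ge0//; split => //.
  by apply/eqP; rewrite eq_complex/= cmod0 !mul0r !eqxx.
pose r := cmod z; have r0 : 0 < r by rewrite cmod_gt0.
pose u := complex.Re z / r; pose v := complex.Im z / r.
have uv : u ^+ 2 + v ^+ 2 = 1.
  by rewrite /u /v !expr_div_n -mulrDl -sqr_cmod divff// expf_neq0// gt_eqF.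
have u1 : -1 <= u <= 1.
  by rewrite -ler_norml -(@ler_pXn2r _ 2)// ?nnegrE// expr1n real_normK ?num_real// -uv lerDl sqr_ge0.
have sv : sin (acos u) = `|v|.
  by rewrite sin_acos// -uv addrC addKr sqrtr_sqr.
have zE : z = (r * u) +i* (r * v).
  by apply/eqP; rewrite eq_complex/= /u /v ![r * _]mulrC !divfK ?eqxx// gt_eqF.
have pi0 := @pi_ge0 R.
(* [acos u] fixes the angle up to reflection in the real axis; the sign of [v] decides. *)
have [v0|v0] := leP 0 v.
  exists (acos u); split.
    by rewrite acos_ge0//= (le_trans (acos_lepi _))//; lra.
  by rewrite {1}zE /polar -/r acosK ?in_itv//= sv ger0_norm.
exists (2 * pi - acos u); split.
  have := acos_ge0 u1; have := acos_lepi u1; lra.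
rewrite {1}zE /polar -/r.
have -> : 2 * pi - acos u = - acos u + pi *+ 2 by rewrite addrC mulr2n -mulr2n mulr_natl.
by rewrite cosD2pi sinD2pi cosN sinN acosK ?in_itv//= sv ltr0_norm// opprK.
Qed.

End PolarExp.

(** * Complex derivatives *)

Section Derivatives.
Context {R : realType}.
Implicit Types (f g : R[i] -> R[i]) (z w : R[i]) (X : R -> R[i]) (t x e : R).

(** Multiplying the difference quotient out by [h] admits [h = 0] and gives real derivatives the
    same shape as [cderiv] and [rcderiv]. *)
Lemma is_derive_epsP (f : R -> R) x (d : R) :
  is_derive x 1 f d <->
  forall e, 0 < e -> exists2 r, 0 < r &
    forall h, `|h| <= r -> `|f (x + h) - f x - d * h| <= e * `|h|.
Proof.
pose q h := h^-1 *: ((f \o shift x) (h *: 1) - f x).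
have qE h : h != 0 -> `|d - q h| = `|f (x + h) - f x - d * h| / `|h|.
  move=> h0; rewrite /q/= /GRing.scale/= mulr1 [h + x]addrC.
  rewrite -normrV ?unitfE// -normrM distrC; congr (`| _ |).
  by field.
have cvgE : q h @[h --> 0^'] --> d <-> forall e, 0 < e -> exists2 r, 0 < r &
    forall h, `|h| <= r -> `|f (x + h) - f x - d * h| <= e * `|h|.
  split=> [/cvgrPdist_le H e e0|H].
    have /nbhs_ballP[r /= r0 Hr] := H _ e0.
    exists (r / 2) => [|h hr]; first by rewrite divr_gt0.
    have [->|h0] := eqVneq h 0.
      by rewrite addr0 subrr mulr0 subr0 normr0 mulr0.
    rewrite -ler_pdivrMr ?normr_gt0// -qE//; apply: Hr => //=.
    by rewrite -ball_normE/= sub0r normrN (le_lt_trans hr)// ltr_pdivrMr// ltr_pMr// ltr1n.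
  apply/cvgrPdist_le => e e0; have [r r0 Hr] := H _ e0.
  apply/nbhs_ballP; exists r => //= h; rewrite -ball_normE/=.
  rewrite sub0r normrN => /ltW hr h0; rewrite qE// ler_pdivrMr ?normr_gt0//.
  exact: Hr.
rewrite -cvgE; split => [[df dv]|H].
  by rewrite -dv; exact: df.
apply: DeriveDef; first by apply/cvg_ex; exists d.
by apply: cvg_lim => //; exact: norm_hausdorff.
Qed.

(** Complex differentiability with real-valued moduli, so that the calculus rules reduce to
    inequalities in [R]. *)
Definition cderiv f z d : Prop := forall e, 0 < e -> exists2 r, 0 < r &
  forall h, cmod h <= r -> cmod (f (z + h) - f z - d * h) <= e * cmod h.

Definition rcderiv X t d : Prop := forall e, 0 < e -> exists2 r, 0 < r &
  forall h : R, `|h| <= r -> cmod (X (t + h) - X t - d * h%:C) <= e * `|h|.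

Definition holo f : Prop := forall z, exists d, cderiv f z d.

Lemma entire_holo f : entire f -> holo f.
Proof.
move=> fE z; have /cvg_ex[d /= /cvgrPdist_le H] := fE z; exists d => e e0.
have e0C : 0 < e%:C :> R[i] by rewrite ltcR.
have /nbhs_ballP[r /= r0 Hr] := H _ e0C.
(* Balls of [R[i]^o] have complex radii; positivity forces the radius to be real. *)
have [r'0 rE] : 0 < complex.Re r /\ r = (complex.Re r)%:C.
  by move: r0 {Hr}; case: (r) => a b; rewrite ltcE/= => /andP[/eqP-> ?].
exists (complex.Re r / 2) => [|h hr]; first by rewrite divr_gt0.
have [->|h0] := eqVneq h 0.
  by rewrite addr0 subrr mulr0 subr0 cmod0 mulr0.
have hr' : ball (0 : R[i]^o) r h.
  rewrite /ball/= sub0r normrN norm_cmod rE ltcR (le_lt_trans hr)//.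
  by rewrite ltr_pdivrMr// ltr_pMr// ltr1n.
have := Hr h hr' h0; rewrite norm_cmod lecR => H1.
have -> : f (z + h) - f z - d * h = - ((d - h^-1 * (f (h * 1 + z) - f z)) * h).
  by rewrite mulr1 [h + z]addrC; field.
by rewrite cmodN cmodM ler_wpM2r ?cmod_ge0.
Qed.

Lemma cderiv_cont f z d : cderiv f z d ->
  forall e, 0 < e -> exists2 r, 0 < r &
    forall h, cmod h <= r -> cmod (f (z + h) - f z) <= e.
Proof.
move=> H e e0; have [r r0 Hr] := H 1 ltr01.
have c0 : 0 < 1 + cmod d by rewrite ltr_wpDr ?cmod_ge0.
exists (Num.min r (e / (1 + cmod d))) => [|h].
  by rewrite lt_min r0 divr_gt0.
rewrite le_min => /andP[hr he].
rewrite -(subrK (d * h) (_ - _)) (le_trans (le_cmodD _ _))//.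
rewrite (le_trans (lerD (Hr _ hr) (lexx _)))// cmodM -mulrDl mulrC.
by rewrite -ler_pdivlMr.
Qed.

Lemma cderiv_eq f z d d' : d = d' -> cderiv f z d -> cderiv f z d'.
Proof. by move->. Qed.

Lemma cderiv_cst (c : R[i]) z : cderiv (fun=> c) z 0.
Proof.
by move=> e e0; exists 1 => // h _; rewrite mul0r subr0 subrr cmod0 mulr_ge0 ?cmod_ge0// ltW.
Qed.

Lemma cderiv_id z : cderiv id z 1.
Proof.
move=> e e0; exists 1 => // h _.
by rewrite /= mul1r [z + h]addrC addrK subrr cmod0 mulr_ge0 ?cmod_ge0// ltW.
Qed.

Lemma cderivD f g z d d' : cderiv f z d -> cderiv g z d' ->
  cderiv (fun w => f w + g w) z (d + d').
Proof.
move=> Hf Hg e e0; have e20 : 0 < e / 2 by rewrite divr_gt0.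
have [r r0 Hr] := Hf _ e20; have [s s0 Hs] := Hg _ e20.
exists (Num.min r s) => [|h]; first by rewrite lt_min r0.
rewrite le_min => /andP[hr hs].
have -> : f (z + h) + g (z + h) - (f z + g z) - (d + d') * h =
  (f (z + h) - f z - d * h) + (g (z + h) - g z - d' * h) by ring.
rewrite (le_trans (le_cmodD _ _))// (le_trans (lerD (Hr _ hr) (Hs _ hs)))//.
by rewrite -mulrDl -splitr.
Qed.

Lemma cderivM f g z d d' : cderiv f z d -> cderiv g z d' ->
  cderiv (fun w => f w * g w) z (d * g z + f z * d').
Proof.
move=> Hf Hg e e0.
pose K := cmod (f z) + cmod (g z) + cmod d + 1.
have K0 : 0 < K by rewrite ltr_wpDl// !addr_ge0 ?cmod_ge0.
(* The error of a product splits into three terms, each at most [m * cmod h * K] with [m] this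
   minimum. *)
have eK : 0 < Num.min 1 (e / (3 * K)) by rewrite lt_min ltr01 divr_gt0 ?mulr_gt0.
have [r r0 Hr] := Hf _ eK; have [s s0 Hs] := Hg _ eK.
have [u u0 Hu] := cderiv_cont _ _ _ Hg _ eK.
exists (Num.min r (Num.min s u)) => [|h]; first by rewrite !lt_min r0 s0.
rewrite !le_min => /and3P[hr hs hu].
have -> : f (z + h) * g (z + h) - f z * g z - (d * g z + f z * d') * h =
  (f (z + h) - f z - d * h) * g z + f z * (g (z + h) - g z - d' * h) +
  (f (z + h) - f z - d * h + d * h) * (g (z + h) - g z) by ring.
have {}Hr := Hr _ hr; have {}Hs := Hs _ hs; have {}Hu := Hu _ hu.
set A := _ - d * h in Hr *; set B := _ - d' * h in Hs *; set D := g _ - g z in Hu *.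
set m := Num.min _ _ in Hr Hs Hu eK.
have m1 : m <= 1 by rewrite ge_min lexx.
have mK : m * (3 * K) <= e by rewrite -ler_pdivlMr ?mulr_gt0// ge_min lexx orbT.
apply: (le_trans (le_cmodD _ _)); apply: (le_trans (lerD (le_cmodD _ _) (lexx _))).
rewrite !cmodM; have hA := le_cmodD A (d * h); rewrite cmodM in hA.
have h0 := cmod_ge0 h; have f0 := cmod_ge0 (f z); have g0 := cmod_ge0 (g z).
have d0 := cmod_ge0 d; have D0 := cmod_ge0 D; have A0 := cmod_ge0 (A + d * h).
have E1 : cmod A * cmod (g z) <= m * cmod h * K.
  by apply: ler_pM; rewrite ?cmod_ge0// /K; lra.
have E2 : cmod (f z) * cmod B <= m * cmod h * K.
  by rewrite mulrC; apply: ler_pM; rewrite ?cmod_ge0// /K; lra.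
have E3 : cmod (A + d * h) * cmod D <= m * cmod h * K.
  rewrite mulrC -mulrA; apply: ler_pM => //.
  apply: (le_trans hA); apply: (@le_trans _ _ (cmod h + cmod d * cmod h)).
    by rewrite lerD2r (le_trans Hr)// ler_piMl.
  by rewrite -[X in X + _]mulr1 [cmod d * _]mulrC -mulrDr ler_wpM2l// /K; lra.
apply: (@le_trans _ _ (m * (3 * K) * cmod h)); last by rewrite ler_wpM2r.
have -> : m * (3 * K) * cmod h = m * cmod h * K + m * cmod h * K + m * cmod h * K by ring.
by rewrite !lerD.
Qed.

Lemma cderiv_comp f g z d d' : cderiv g z d' -> cderiv f (g z) d ->
  cderiv (fun w => f (g w)) z (d * d').
Proof.
move=> Hg Hf e e0.
pose K := cmod d + cmod d' + 1.
have K0 : 0 < K by rewrite ltr_wpDl// !addr_ge0 ?cmod_ge0.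
have eK : 0 < Num.min 1 (e / (2 * K)) by rewrite lt_min ltr01 divr_gt0 ?mulr_gt0.
have [r r0 Hr] := Hf _ eK; have [s s0 Hs] := Hg _ eK.
have [u u0 Hu] := cderiv_cont _ _ _ Hg _ r0.
exists (Num.min s u) => [|h]; first by rewrite lt_min s0.
rewrite le_min => /andP[hs hu].
have {}Hu := Hu _ hu; have {}Hr := Hr _ Hu; have {}Hs := Hs _ hs.
rewrite [g z + _]addrC subrK in Hr.
set k := g (z + h) - g z in Hr Hs Hu.
set m := Num.min _ _ in Hr Hs eK.
have m1 : m <= 1 by rewrite ge_min lexx.
have mK : m * (2 * K) <= e by rewrite -ler_pdivlMr ?mulr_gt0// ge_min lexx orbT.
have h0 := cmod_ge0 h; have d0 := cmod_ge0 d; have d'0 := cmod_ge0 d'.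
have kh : cmod k <= K * cmod h.
  rewrite -(subrK (d' * h) k) (le_trans (le_cmodD _ _))// cmodM.
  rewrite (le_trans (lerD Hs (lexx _)))// -mulrDl ler_wpM2r// /K; lra.
have -> : f (g (z + h)) - f (g z) - d * d' * h =
  (f (g (z + h)) - f (g z) - d * k) + d * (k - d' * h) by rewrite /k; ring.
rewrite (le_trans (le_cmodD _ _))// cmodM.
apply: (@le_trans _ _ (m * (2 * K) * cmod h)); last by rewrite ler_wpM2r.
have -> : m * (2 * K) * cmod h = m * (K * cmod h) + K * (m * cmod h) by ring.
apply: lerD; first by rewrite (le_trans Hr)// ler_wpM2l// ltW.
by apply: ler_pM; rewrite ?cmod_ge0// /K; lra.
Qed.

(** Only the origin needs the derivatives of exp, cos and sin; the addition theorem carries the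
    result to every point. The real and the imaginary part each contribute errors of total size
    [3 * m * cmod h], whence [e / 6]. *)
Lemma cderiv_cexp0 : cderiv cexp 0 1.
Proof.
move=> e e0; have e60 : 0 < Num.min (e / 6) 1 by rewrite lt_min divr_gt0//=.
have [r1 r10 H1] := (is_derive_epsP _ _ _).1 (@is_derive_expR R 0) _ e60.
have [r2 r20 H2] := (is_derive_epsP _ _ _).1 (@is_derive_cos R 0) _ e60.
have [r3 r30 H3] := (is_derive_epsP _ _ _).1 (@is_derive_sin R 0) _ e60.
set m := Num.min _ 1 in e60 H1 H2 H3.
exists (Num.min (Num.min r1 (m / 2)) (Num.min r2 r3)) => [|h].
  by rewrite !lt_min r10 r20 r30 divr_gt0.
rewrite !le_min => /andP[/andP[h1 hm] /andP[h2 h3]].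
have m1 : m <= 1 by rewrite ge_min lexx orbT.
have m6 : 6 * m <= e by rewrite mulrC -ler_pdivlMr// ge_min lexx.
have Rh := Re_le_cmod h; have Ih := Im_le_cmod h; have h0 := cmod_ge0 h.
set a := complex.Re h in Rh; set b := complex.Im h in Ih.
have {}H1 := H1 a (le_trans Rh h1).
have {}H2 := H2 b (le_trans Ih h2).
have {}H3 := H3 b (le_trans Ih h3).
rewrite !add0r expR0 mul1r in H1.
rewrite !add0r cos0 sin0 oppr0 mul0r subr0 in H2.
rewrite !add0r cos0 sin0 mul1r subr0 in H3.
rewrite add0r cexp0 mul1r.
have Ra : `|a| <= 1 / 2 by lra.
have mh : m * cmod h <= cmod h by rewrite ler_piMl.
have ma : m * `|a| <= m * cmod h by rewrite ler_wpM2l// ltW.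
have mb : m * `|b| <= m * cmod h by rewrite ler_wpM2l// ltW.
have E1 : `|expR a - 1| <= m.
  rewrite -(subrK a (_ - 1)) (le_trans (ler_normD _ _))//; lra.
have E2 : `|expR a| <= 2.
  rewrite -(subrK 1 (expR a)) (le_trans (ler_normD _ _))// normr1; lra.
apply: (le_trans (le_cmod_ReIm _)); rewrite !cReB !cImB/= -/a -/b.
have -> : expR a * cos b - 1 - a = expR a * (cos b - 1) + (expR a - 1 - a) by ring.
have -> : expR a * sin b - 0 - b = expR a * (sin b - b) + (expR a - 1) * b by ring.
apply: (@le_trans _ _ ((2 * (m * cmod h) + m * cmod h) + (2 * (m * cmod h) + m * cmod h))).
  apply: lerD; apply: (le_trans (ler_normD _ _)); rewrite !normrM; apply: lerD.
  - by apply: ler_pM => //; apply: le_trans H2 mb.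
  - exact: le_trans H1 ma.
  - by apply: ler_pM => //; apply: le_trans H3 mb.
  - by apply: ler_pM.
have -> : 2 * (m * cmod h) + m * cmod h + (2 * (m * cmod h) + m * cmod h) = 6 * m * cmod h by ring.
by rewrite ler_wpM2r.
Qed.

Lemma cderiv_cexp z : cderiv cexp z (cexp z).
Proof.
move=> e e0.
have c0 : 0 < cmod (cexp z) by rewrite cmod_cexp expR_gt0.
have [r r0 Hr] := cderiv_cexp0 _ (divr_gt0 e0 c0).
exists r => // h hr; have {}Hr := Hr h hr.
rewrite cexpD.
have -> : cexp z * cexp h - cexp z - cexp z * h = cexp z * (cexp (0 + h) - cexp 0 - 1 * h).
  by rewrite add0r cexp0; ring.
by rewrite cmodM mulrC -ler_pdivlMr// mulrAC.
Qed.

Lemma cderiv_poly (p : {poly R[i]}) z : cderiv (fun w => p.[w]) z p^`().[z].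
Proof.
elim/poly_ind: p => [|p c IH].
  under [X in cderiv X]eq_fun do rewrite horner0.
  rewrite deriv0 horner0; exact: cderiv_cst.
rewrite (_ : (fun w => _) = fun w => p.[w] * w + c); last first.
  by apply/funext => w; rewrite hornerMXaddC.
have := cderivD _ _ _ _ _ (cderivM _ _ _ _ _ IH (cderiv_id z)) (cderiv_cst c z).
apply: cderiv_eq.
by rewrite derivMXaddC !hornerE/=; ring.
Qed.

Lemma holo_cst (c : R[i]) : holo (fun=> c).
Proof. by move=> z; exists 0; exact: cderiv_cst. Qed.

Lemma holo_id : holo id.
Proof. by move=> z; exists 1; exact: cderiv_id. Qed.

Lemma holoD f g : holo f -> holo g -> holo (fun z => f z + g z).
Proof.
by move=> F G z; have [d D] := F z; have [d' D'] := G z; exists (d + d'); exact: cderivD.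
Qed.

Lemma holoM f g : holo f -> holo g -> holo (fun z => f z * g z).
Proof.
move=> F G z; have [d D] := F z; have [d' D'] := G z.
by exists (d * g z + f z * d'); exact: cderivM.
Qed.

Lemma holo_comp f g : holo f -> holo g -> holo (fun z => f (g z)).
Proof.
move=> F G z; have [d D] := G z; have [d' D'] := F (g z).
by exists (d' * d); exact: cderiv_comp.
Qed.

Lemma holo_cexp : holo cexp.
Proof. by move=> z; exists (cexp z); exact: cderiv_cexp. Qed.

Lemma holo_poly (p : {poly R[i]}) : holo (fun z => p.[z]).
Proof. by move=> z; eexists; exact: cderiv_poly. Qed.

Lemma holo_sum (I : Type) (r : seq I) (F : I -> R[i] -> R[i]) :
  (forall i, holo (F i)) -> holo (fun z => \sum_(i <- r) F i z).
Proof.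
move=> H; elim: r => [|i r IH].
  by under [X in holo X]eq_fun do rewrite big_nil; exact: holo_cst.
by under [X in holo X]eq_fun do rewrite big_cons; exact: holoD.
Qed.

Lemma holo_cont f : holo f -> forall z e, 0 < e -> exists2 r, 0 < r &
  forall w, cmod (w - z) <= r -> cmod (f w - f z) <= e.
Proof.
move=> F z e e0; have [d D] := F z; have [r r0 Hr] := cderiv_cont _ _ _ D _ e0.
by exists r => // w wr; have := Hr _ wr; rewrite [z + _]addrC subrK.
Qed.

(** The bridge to real calculus: a unit [c] serves for estimates of moduli, while [c = 1] and
    [c = - i] extract the real and imaginary parts. *)
Lemma rcderiv_Re (c : R[i]) X t d : rcderiv X t d ->
  is_derive t 1 (fun s => complex.Re (c * X s)) (complex.Re (c * d)).
Proof.
move=> H; apply/is_derive_epsP => e e0.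
have c0 : 0 < cmod c + 1 by rewrite ltr_wpDl ?cmod_ge0.
have [r r0 Hr] := H _ (divr_gt0 e0 c0); exists r => // h hr.
have -> : complex.Re (c * X (t + h)) - complex.Re (c * X t) - complex.Re (c * d) * h =
   complex.Re (c * (X (t + h) - X t - d * h%:C)).
  rewrite [_ * h]mulrC -cReZ -!cReB; congr complex.Re; ring.
rewrite (le_trans (Re_le_cmod _))// cmodM.
apply: (@le_trans _ _ ((cmod c + 1) * (e / (cmod c + 1) * `|h|))).
  by apply: ler_pM; rewrite ?cmod_ge0 ?lerDl//; exact: Hr.
by rewrite mulrA [_ * (e / _)]mulrC divfK// gt_eqF.
Qed.

Lemma cderiv_line f (a b : R[i]) t d : cderiv f (a + t%:C * b) d ->
  rcderiv (fun s => f (a + s%:C * b)) t (d * b).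
Proof.
move=> H e e0.
have b0 : 0 < cmod b + 1 by rewrite ltr_wpDl ?cmod_ge0.
have [r r0 Hr] := H _ (divr_gt0 e0 b0).
exists (r / (cmod b + 1)) => [|h]; first by rewrite divr_gt0.
rewrite ler_pdivlMr// => hr.
have hb : cmod (h%:C * b) <= `|h| * (cmod b + 1).
  by rewrite cmodM cmod_real ler_wpM2l// lerDl.
have := Hr _ (le_trans hb hr).
have -> : a + t%:C * b + h%:C * b = a + (t + h)%:C * b by rewrite rmorphD/=; ring.
rewrite -[d * b * _]mulrA [b * _]mulrC => /le_trans; apply.
rewrite mulrAC ler_pdivrMr// -mulrA ler_wpM2l//; exact: ltW.
Qed.

Lemma rcderiv_pair (U V : R -> R) t u v : is_derive t 1 U u -> is_derive t 1 V v ->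
  rcderiv (fun s => U s +i* V s) t (u +i* v).
Proof.
move=> /is_derive_epsP HU /is_derive_epsP HV e e0.
have e20 : 0 < e / 2 by rewrite divr_gt0.
have [r r0 Hr] := HU _ e20; have [s s0 Hs] := HV _ e20.
exists (Num.min r s) => [|h]; first by rewrite lt_min r0.
rewrite le_min => /andP[hr hs].
rewrite (le_trans (le_cmod_ReIm _))// !cReB !cImB/= !mulr0 subr0 add0r.
by rewrite (le_trans (lerD (Hr _ hr) (Hs _ hs)))// -mulrDl -splitr.
Qed.

Lemma rcderivB X (Y : R -> R[i]) t d d' : rcderiv X t d -> rcderiv Y t d' ->
  rcderiv (fun s => X s - Y s) t (d - d').
Proof.
move=> Hf Hg e e0; have e20 : 0 < e / 2 by rewrite divr_gt0.
have [r r0 Hr] := Hf _ e20; have [s s0 Hs] := Hg _ e20.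
exists (Num.min r s) => [|h]; first by rewrite lt_min r0.
rewrite le_min => /andP[hr hs].
have -> : X (t + h) - Y (t + h) - (X t - Y t) - (d - d') * h%:C =
  (X (t + h) - X t - d * h%:C) - (Y (t + h) - Y t - d' * h%:C) by ring.
rewrite (le_trans (le_cmodB _ _))// (le_trans (lerD (Hr _ hr) (Hs _ hs)))//.
by rewrite -mulrDl -splitr.
Qed.

Lemma is_derive_continuous (f df : R -> R) :
  (forall x, is_derive x 1 f (df x)) -> continuous f.
Proof. by move=> H x; apply: differentiable_continuous; apply/derivable1_diffP; have [] := H x. Qed.

Lemma is_derive_continuous_at (f : R -> R) x (d : R) : is_derive x 1 f d -> {for x, continuous f}.
Proof. by move=> [H _]; apply: differentiable_continuous; apply/derivable1_diffP. Qed.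

(** A unit [c] rotates the increment of [X] onto the positive axis, and [B - Re (c X)] has a
    nonnegative derivative. A varying majorant [B] is allowed because the bounds along rays decay
    exponentially. *)
Lemma mvi_cmp X X' (B B' : R -> R) a b : a <= b ->
  (forall t, a <= t <= b -> rcderiv X t (X' t)) ->
  (forall t, a <= t <= b -> is_derive t 1 B (B' t)) ->
  (forall t, a <= t <= b -> cmod (X' t) <= B' t) ->
  cmod (X b - X a) <= B b - B a.
Proof.
move=> ab HX HB HXB; have [c [c1 cE]] := unit_rotation (X b - X a).
rewrite -cE mulrBr cReB -subr_ge0.
pose f t := B t - complex.Re (c * X t); pose f' t := B' t - complex.Re (c * X' t).
have df t : a <= t <= b -> is_derive t 1 f (f' t).
  by move=> tab; apply: is_deriveB; [exact: HB | apply: rcderiv_Re; exact: HX].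
have f'0 t : a <= t <= b -> 0 <= f' t.
  move=> tab; rewrite subr_ge0 (le_trans (ler_Re_cmod _))// cmodM c1 mul1r.
  exact: HXB.
have [||t tab fE] := @MVT_segment _ f f' _ _ ab.
- by move=> x; rewrite in_itv/= => /andP[/ltW ax /ltW xb]; apply: df; rewrite ax.
- apply: continuous_in_subspaceT => x; rewrite inE/= in_itv/= => xab.
  exact: is_derive_continuous_at (df x xab).
have -> : B b - B a - (complex.Re (c * X b) - complex.Re (c * X a)) = f b - f a.
  by rewrite /f; ring.
by rewrite fE; apply: mulr_ge0; [exact: f'0 | rewrite subr_ge0].
Qed.

Lemma mvi X X' M a b :
  (forall t, Num.min a b <= t <= Num.max a b -> rcderiv X t (X' t)) ->
  (forall t, Num.min a b <= t <= Num.max a b -> cmod (X' t) <= M) ->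
  cmod (X b - X a) <= M * `|b - a|.
Proof.
move=> HX HM.
have H c d : c <= d -> (forall t, c <= t <= d -> rcderiv X t (X' t)) ->
    (forall t, c <= t <= d -> cmod (X' t) <= M) ->
    cmod (X d - X c) <= M * (d - c).
  move=> cd H1 H2; rewrite mulrBr.
  apply: (mvi_cmp X X' (fun t => M * t) (fun=> M)) => // t _.
  by apply: is_derive_eq; rewrite scaler1.
have [ab|/ltW ba] := leP a b.
  rewrite ger0_norm ?subr_ge0//; apply: H => // t tab; [apply: HX|apply: HM];
  by rewrite min_l ?max_r.
rewrite distrC cmodBC ger0_norm ?subr_ge0//; apply: H => // t tab; [apply: HX|apply: HM];
by rewrite min_r ?max_l.
Qed.

Lemma mvi_line f f' (a b : R[i]) M :
  (forall z, cderiv f z (f' z)) ->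
  (forall t : R, 0 <= t <= 1 -> cmod (f' (a + t%:C * (b - a))) <= M) ->
  cmod (f b - f a) <= M * cmod (b - a).
Proof.
move=> Hf HM.
have := @mvi (fun t => f (a + t%:C * (b - a))) (fun t => f' (a + t%:C * (b - a)) * (b - a))
  (M * cmod (b - a)) 0 1.
rewrite /= mul1r mul0r addr0 [a + _]addrC subrK subr0 normr1 mulr1; apply => t.
  by move=> _; apply: cderiv_line; exact: Hf.
rewrite min_l ?max_r// => t01; rewrite cmodM ler_wpM2r ?cmod_ge0//; exact: HM.
Qed.

End Derivatives.

(** * Primitives of holomorphic functions *)

Section Primitives.
Context {R : realType}.
Implicit Types (g G : R -> R) (f F : R[i] -> R[i]) (z w : R[i]) (x y t e : R).

Lemma is_derive0_cst g (a b : R) : a <= b ->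
  (forall t, a <= t <= b -> is_derive t 1 g 0) -> g b = g a.
Proof.
move=> ab H; apply/eqP; rewrite -subr_eq0.
have [||t tab ->] := @MVT_segment _ g (fun=> 0) _ _ ab.
- by move=> x; rewrite in_itv/= => /andP[/ltW ax /ltW xb]; apply: H; rewrite ax.
- apply: continuous_in_subspaceT => x; rewrite inE/= in_itv/= => xab.
  exact: is_derive_continuous_at (H x xab).
by rewrite mul0r.
Qed.

(** The integral from [- N] is a primitive only to the right of [- N]. Normalised to vanish at 0,
    two such integrals agree where both are primitives, so [N] may vary with [x]; near [x] the
    single choice [|x| + 2] serves. *)
Lemma ex_primitive g : continuous g -> exists G, forall x, is_derive x 1 G (g x).
Proof.
move=> gc.
pose GN N x := \int[lebesgue_measure]_(t in [set` Interval (BLeft (- N)) (BRight x)]) g t.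
have dGN N x : - N < x -> is_derive x 1 (GN N) (g x).
  move=> Nx; have [||||d1 d2] := @continuous_FTC1 R g (BLeft (- N)) x (x + 1).
  - by rewrite ltrDl.
  - apply: continuous_compact_integrable; first exact: segment_compact.
    exact: continuous_subspaceT.
  - by rewrite lte_fin.
  - exact: gc.
  by apply: DeriveDef; [exact: d1 | rewrite -derive1E; exact: d2].
pose G x := GN (`|x| + 1) x - GN (`|x| + 1) 0.
have GE N M x : `|x| < N -> `|x| < M -> GN N x - GN N 0 = GN M x - GN M 0.
  move=> xN xM; suff H : forall s t, s <= t -> - `|x| <= s -> t <= `|x| ->
      GN N t - GN M t = GN N s - GN M s.
    have x0 := normr_ge0 x.
    have [x00|x00] := leP 0 x; [have := H 0 x x00|have := H x 0 (ltW x00)].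
      by rewrite ger0_norm// => /(_ _ (lexx _)); rewrite oppr_le0 => /(_ x00); lra.
    by rewrite ltr0_norm// opprK => /(_ (lexx _)); rewrite oppr_ge0 => /(_ (ltW x00)); lra.
  move=> s t st sx tx; apply: (@is_derive0_cst (fun t => GN N t - GN M t)) => // u /andP[su ut].
  rewrite -(subrr (g u)); apply: is_deriveB; apply: dGN; lra.
exists G => x; apply/is_derive_epsP => e e0.
have dx : is_derive x 1 (GN (`|x| + 2)) (g x).
  by apply: dGN; rewrite ltrNl (le_lt_trans (ler_norm _))// normrN ltrDl.
have [r r0 Hr] := (is_derive_epsP _ _ _).1 dx _ e0.
exists (Num.min r 1) => [|h]; first by rewrite lt_min r0/=.
rewrite le_min => /andP[hr h1].
have hx := ler_normD x h.
rewrite /G (GE _ (`|x| + 2) (x + h)); [|lra|lra].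
rewrite (GE _ (`|x| + 2) x); [|lra|lra].
by have := Hr h hr; congr (`| _ | <= _); ring.
Qed.

Lemma Rintegral_primitive g G (a b : R) : a < b -> continuous g ->
  (forall x, is_derive x 1 G (g x)) ->
  \int[lebesgue_measure]_(x in `[a, b]) g x = G b - G a.
Proof.
move=> ab gc dG; rewrite /Rintegral (@continuous_FTC2 _ _ G)//.
- exact: continuous_subspaceT.
- have Gc := is_derive_continuous _ _ dG; split.
  + by move=> x _; have [] := dG x.
  + exact/cvg_at_right_filter/Gc.
  + exact/cvg_at_left_filter/Gc.
- by move=> x _; rewrite derive1E; have [_ ->] := dG x.
Qed.

(** The intervals with centre [u n] and radius [K / 2 ^+ n] are nested, so the supremum of their
    left ends lies in all of them. *)
Lemma geometric_cauchy_cvg (u : nat -> R) (K : R) :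
  (forall n, `|u n.+1 - u n| <= K / 2 ^+ n.+1) ->
  exists l, forall n, `|u n - l| <= K / 2 ^+ n.
Proof.
move=> H.
have E n : K / 2 ^+ n = K / 2 ^+ n.+1 + K / 2 ^+ n.+1.
  by rewrite exprS; field; rewrite expf_neq0.
pose v n := u n - K / 2 ^+ n; pose w n := u n + K / 2 ^+ n.
have vS n : v n <= v n.+1.
  by rewrite /v (E n); have := H n; rewrite ler_norml => /andP[]; lra.
have wS n : w n.+1 <= w n.
  by rewrite /w (E n); have := H n; rewrite ler_norml => /andP[]; lra.
have vw n : v n <= w n.
  rewrite /v /w; have : 0 <= K / 2 ^+ n.+1 by exact: le_trans (H n).
  by rewrite (E n); lra.
have vm n m : (n <= m)%N -> v n <= v m.
  by elim: m => [|m IH]; rewrite leq_eqVlt => /orP[/eqP->//|//]; rewrite ltnS => /IH/le_trans; apply.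
have wm n m : (n <= m)%N -> w m <= w n.
  elim: m => [|m IH]; rewrite leq_eqVlt => /orP[/eqP->//|//]; rewrite ltnS => /IH; exact: le_trans.
have vwnm n m : v n <= w m.
  have [nm|/ltnW mn] := leqP n m; first exact: le_trans (vm _ _ nm) (vw m).
  exact: le_trans (vw n) (wm _ _ mn).
exists (sup (range v)) => n.
have v0 : range v !=set0 by exists (v 0%N); exists 0%N.
have H1 : v n <= sup (range v).
  by apply: ub_le_sup; [exists (w 0%N) => _ [m _ <-]; exact: vwnm | exists n].
have H2 : sup (range v) <= w n.
  by apply: ge_sup => // _ [m _ <-]; exact: vwnm.
by rewrite ler_norml; rewrite /v /w in H1 H2; apply/andP; split; lra.
Qed.

Lemma ex_div_pow2_le (K e : R) : 0 < e -> exists n, K / 2 ^+ n <= e.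
Proof.
move=> e0; have [K0|K0] := leP K 0.
  by exists 0%N; rewrite expr0 divr1 (le_trans K0)// ltW.
exists (Num.bound (K / e)).
rewrite ler_pdivrMr ?exprn_gt0// mulrC -ler_pdivrMr//.
rewrite (le_trans (ltW (archi_boundP _)))//; first by rewrite divr_ge0 ?ltW.
by rewrite -natrX ler_nat ltnW// ltn_expl.
Qed.

(** * Goursat's theorem for rectangles and the resulting primitive *)

Section Goursat.
(** Line integrals are increments of one-variable primitives: [X y] on the horizontal line at height
    [y], [Y x] on the vertical line at abscissa [x]. The latter is taken in the real parameter,
    whence the factor i in [bdry]. *)
Variables (f : R[i] -> R[i]) (X Y : R -> R -> R[i]).
Hypothesis fH : holo f.
Hypothesis HX : forall y x, rcderiv (X y) x (f (x +i* y)).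
Hypothesis HY : forall x y, rcderiv (Y x) y (f (x +i* y)).

(* [bdry a b c d] is the integral of [f] along the boundary of [a, b] x [c, d]. *)
Let bdry a b c d : R[i] :=
  X c b - X c a - (X d b - X d a) + 'i%C * (Y b d - Y b c - (Y a d - Y a c)).

Lemma bdry_split a m b c n d :
  bdry a b c d = bdry a m c n + bdry m b c n + bdry a m n d + bdry m b n d.
Proof. by rewrite /bdry; ring. Qed.

(** Primitives of affine functions, for integrating the first-order Taylor polynomial of [f] along
    the edges of a rectangle. *)
Lemma rcderiv_quad (A B w : R[i]) t :
  rcderiv (fun s => A * s%:C + B * (s%:C * s%:C / 2 + w * s%:C)) t (A + B * (t%:C + w)).
Proof.
pose P z := A * z + B * (z * z * 2^-1 + w * z).
have dP z : cderiv P z (A + B * (z + w)).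
  have id := cderiv_id z.
  have := cderivD _ _ _ _ _ (cderivM _ _ _ _ _ (cderiv_cst A z) id)
    (cderivM _ _ _ _ _ (cderiv_cst B z) (cderivD _ _ _ _ _
      (cderivM _ _ _ _ _ (cderivM _ _ _ _ _ id id) (cderiv_cst 2^-1 z))
      (cderivM _ _ _ _ _ (cderiv_cst w z) id))).
  by apply: cderiv_eq => /=; field.
have := @cderiv_line _ P 0 1 t _ (dP _).
rewrite add0r !mulr1; congr (rcderiv _ _ _).
by apply/funext => s; rewrite add0r mulr1.
Qed.

(** The Taylor polynomial of [f] at [z0] has boundary integral 0 by its explicit primitives [LX] and
    [LY]. The remainder is at most [e * (u + v)] on edges of length at most [2 * u] and [2 * v], two
    of each, which gives the factor 4. *)
Lemma bdry_local (x0 y0 e : R) : 0 < e -> exists2 r, 0 < r &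
  forall a b c d u v,
    `|a - x0| <= u -> `|b - x0| <= u -> `|c - y0| <= v -> `|d - y0| <= v ->
    u + v <= r -> cmod (bdry a b c d) <= 4 * e * (u + v) ^+ 2.
Proof.
move=> e0; pose z0 := x0 +i* y0; have [B dB] := fH z0; have [r r0 Hr] := dB _ e0.
exists r => // a b c d u v au bu cv dv uvr.
pose A := f z0.
have fl x y : `|x - x0| <= u -> `|y - y0| <= v ->
    cmod (f (x +i* y) - (A + B * (x +i* y - z0))) <= e * (u + v).
  move=> xu yv; pose h := (x - x0) +i* (y - y0).
  have hE : x +i* y - z0 = h by apply/eqP; rewrite eq_complex/= !eqxx.
  have huv : cmod h <= u + v by rewrite (le_trans (le_cmod_ReIm _))//= lerD.
  have := Hr _ (le_trans huv uvr); rewrite -hE [z0 + _]addrC subrK opprD addrA => /le_trans.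
  by apply; rewrite ler_pM2l// hE.
have btw (p q p0 w t : R) : `|p - p0| <= w -> `|q - p0| <= w ->
    Num.min p q <= t <= Num.max p q -> `|t - p0| <= w.
  move=> pw qw; have [pq|qp] := leP p q => /andP[t1 t2]; 
  by move: pw qw; rewrite !ler_norml => /andP[? ?] /andP[? ?]; apply/andP; split; lra.
have dist (p q p0 w : R) : `|p - p0| <= w -> `|q - p0| <= w -> `|q - p| <= 2 * w.
  by rewrite !ler_norml => /andP[? ?] /andP[? ?]; apply/andP; split; lra.
have u0 : 0 <= u by exact: le_trans au.
have v0 : 0 <= v by exact: le_trans cv.
have euv : 0 <= e * (u + v) by rewrite mulr_ge0 ?addr_ge0// ltW.
pose LX y x := A * x%:C + B * (x%:C * x%:C / 2 + ((0 +i* y) - z0) * x%:C).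
pose LY x y := A * y%:C + 'i%C * (B * (y%:C * y%:C / 2 + - 'i%C * (x%:C - z0) * y%:C)).
have ptE x y : x +i* y = x%:C + 'i%C * y%:C :> R[i].
  by rewrite [LHS]complexE.
have HXy y : `|y - y0| <= v ->
    cmod ((X y b - LX y b) - (X y a - LX y a)) <= e * (u + v) * (2 * u).
  move=> yv; apply: (@le_trans _ _ (e * (u + v) * `|b - a|)); last first.
    by apply: ler_wpM2l => //; exact: dist au bu.
  apply: (mvi (fun x => X y x - LX y x) (fun x => f (x +i* y) - (A + B * (x%:C + ((0 +i* y) - z0))))) => t tab.
    by apply: rcderivB; [exact: HX | exact: rcderiv_quad].
  have -> : t%:C + ((0 +i* y) - z0) = (t +i* y) - z0 by rewrite (ptE 0 y) (ptE t y) rmorph0; ring.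
  by apply: fl => //; exact: btw au bu tab.
have HYx x : `|x - x0| <= u ->
    cmod ((Y x d - LY x d) - (Y x c - LY x c)) <= e * (u + v) * (2 * v).
  move=> xu; apply: (@le_trans _ _ (e * (u + v) * `|d - c|)); last first.
    by apply: ler_wpM2l => //; exact: dist cv dv.
  apply: (mvi (fun y => Y x y - LY x y) (fun y => f (x +i* y) - (A + 'i%C * B * (y%:C + - 'i%C * (x%:C - z0))))) => t tab.
    apply: rcderivB; first exact: HY.
    have := rcderiv_quad A ('i%C * B) (- 'i%C * (x%:C - z0)) t.
    by congr (rcderiv _ _ _); apply/funext => s; rewrite /LY; ring.
  have -> : A + 'i%C * B * (t%:C + - 'i%C * (x%:C - z0)) = A + B * ((x +i* t) - z0).
    have ii : 'i%C * 'i%C = -1 :> R[i] by rewrite -expr2 sqr_i.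
    transitivity (A + B * ('i%C * t%:C - ('i%C * 'i%C) * (x%:C - z0))); first ring.
    by rewrite ii (ptE x t); ring.
  by apply: fl => //; exact: btw cv dv tab.
have LE : LX c b - LX c a - (LX d b - LX d a) + 'i%C * (LY b d - LY b c - (LY a d - LY a c)) = 0.
  have ii : 'i%C * 'i%C = -1 :> R[i] by rewrite -expr2 sqr_i.
  rewrite /LX /LY (ptE 0 c) (ptE 0 d) rmorph0.
  transitivity (B * 'i%C * (c%:C - d%:C) * (b%:C - a%:C) * (1 + 'i%C * 'i%C)); first by field.
  by rewrite ii subrr mulr0.
have -> : bdry a b c d =
    ((X c b - LX c b) - (X c a - LX c a)) - ((X d b - LX d b) - (X d a - LX d a)) +
    'i%C * (((Y b d - LY b d) - (Y b c - LY b c)) - ((Y a d - LY a d) - (Y a c - LY a c))).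
  by rewrite /bdry -[LHS]subr0 -LE; ring.
apply: (le_trans (le_cmodD _ _)); rewrite cmodM cmod_i mul1r.
apply: (le_trans (lerD (le_cmodB _ _) (le_cmodB _ _))).
apply: (le_trans (lerD (lerD (HXy _ cv) (HXy _ dv)) (lerD (HYx _ bu) (HYx _ au)))).
by rewrite le_eqVlt; apply/orP; left; apply/eqP; ring.
Qed.

(* Goursat: repeated quartering isolates a point near which [bdry_local] is violated. *)
Lemma bdry_eq0 a b c d : bdry a b c d = 0.
Proof.
apply/eqP; rewrite -cmod_eq0; apply/eqP/le_anti; rewrite cmod_ge0 andbT leNgt.
apply/negP => j0.
pose W := b - a; pose H := d - c; pose j := cmod (bdry a b c d).
(* A rectangle of generation [n] is determined by its corner [q]. The sides [W] and [H] are signed,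
   which is why absolute values appear below. *)
pose J n (q : R * R) := bdry q.1 (q.1 + W / 2 ^+ n) q.2 (q.2 + H / 2 ^+ n).
have step n q : exists q' : R * R, [/\ cmod (J n q) <= 4 * cmod (J n.+1 q'),
    `|q'.1 - q.1| <= `|W| / 2 ^+ n.+1 & `|q'.2 - q.2| <= `|H| / 2 ^+ n.+1].
  case: q => x y; pose w := W / 2 ^+ n.+1; pose h := H / 2 ^+ n.+1.
  have E (K : R) : K / 2 ^+ n = K / 2 ^+ n.+1 + K / 2 ^+ n.+1.
    by rewrite exprS; field; rewrite expf_neq0.
  have aw (K : R) : `|K / 2 ^+ n.+1| = `|K| / 2 ^+ n.+1.
    by rewrite normrM normfV [`|2 ^+ _|]ger0_norm// exprn_ge0.
  have K0 (K : R) : 0 <= `|K| / 2 ^+ n.+1 by rewrite divr_ge0// exprn_ge0.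
  have JE : J n (x, y) = J n.+1 (x, y) + J n.+1 (x + w, y) + J n.+1 (x, y + h) + J n.+1 (x + w, y + h).
    by rewrite /J/= (bdry_split _ (x + w) _ _ (y + h)) (E W) (E H) !addrA.
  have D q : q.1 = x \/ q.1 = x + w -> q.2 = y \/ q.2 = y + h ->
      `|q.1 - x| <= `|W| / 2 ^+ n.+1 /\ `|q.2 - y| <= `|H| / 2 ^+ n.+1.
    by move=> [] -> [] ->; rewrite ?subrr ?normr0 ?[_ + w]addrC ?[_ + h]addrC ?addrK ?aw.
  have S : cmod (J n (x, y)) <= cmod (J n.+1 (x, y)) + cmod (J n.+1 (x + w, y)) +
      cmod (J n.+1 (x, y + h)) + cmod (J n.+1 (x + w, y + h)).
    rewrite JE (le_trans (le_cmodD _ _))// lerD2r (le_trans (le_cmodD _ _))// lerD2r.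
    exact: le_cmodD.
  have [h1|h1] := leP (cmod (J n (x, y))) (4 * cmod (J n.+1 (x, y))).
    by exists (x, y); have [] := D (x, y) (or_introl erefl) (or_introl erefl).
  have [h2|h2] := leP (cmod (J n (x, y))) (4 * cmod (J n.+1 (x + w, y))).
    by exists (x + w, y); have [] := D (x + w, y) (or_intror erefl) (or_introl erefl).
  have [h3|h3] := leP (cmod (J n (x, y))) (4 * cmod (J n.+1 (x, y + h))).
    by exists (x, y + h); have [] := D (x, y + h) (or_introl erefl) (or_intror erefl).
  exists (x + w, y + h); have [] := D (x + w, y + h) (or_intror erefl) (or_intror erefl).
  by split => //; lra.
pose Q n := projT1 (choice (step n)).
have HQ n : forall q, _ := projT2 (choice (step n)).
pose q := fix q n : R * R := if n is m.+1 then Q m (q m) else (a, c).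
have [x0 Hx0] := geometric_cauchy_cvg (fun n => (q n).1) `|W| (fun n => let: And3 _ p _ := HQ n (q n) in p).
have [y0 Hy0] := geometric_cauchy_cvg (fun n => (q n).2) `|H| (fun n => let: And3 _ _ p := HQ n (q n) in p).
have Jq n : j <= 4 ^+ n * cmod (J n (q n)).
  elim: n => [|n IH].
    by rewrite expr0 mul1r /J/= expr0 !divr1 /W /H [a + _]addrC [c + _]addrC !subrK.
  rewrite (le_trans IH)// exprSr -mulrA ler_pM2l ?exprn_gt0//.
  by have [] := HQ n (q n).
(* With s = (|W| + |H|)^2, the local bound multiplied by 4^n equals 16 e s, which is less than 32 (s
   + 1) e = j. The summand 1 keeps the denominator positive. *)
pose e := j / (32 * ((`|W| + `|H|) ^+ 2 + 1)).
have p0 : 0 < (`|W| + `|H|) ^+ 2 + 1 by rewrite ltr_wpDl// sqr_ge0.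
have e0 : 0 < e by rewrite divr_gt0// mulr_gt0.
have [r r0 Hr] := bdry_local x0 y0 e e0.
have [n Hn] := ex_div_pow2_le (2 * (`|W| + `|H|)) r r0.
have K0 (K : R) : `|K / 2 ^+ n| = `|K| / 2 ^+ n.
  by rewrite normrM normfV [`|2 ^+ _|]ger0_norm// exprn_ge0.
have K1 (K : R) : 0 <= `|K| / 2 ^+ n by rewrite divr_ge0// exprn_ge0.
have corner x l K : `|x - l| <= `|K| / 2 ^+ n ->
    `|x - l| <= 2 * (`|K| / 2 ^+ n) /\ `|x + K / 2 ^+ n - l| <= 2 * (`|K| / 2 ^+ n).
  move=> xl; split; first by have := K1 K; lra.
  rewrite addrAC (le_trans (ler_normD _ _))// K0; lra.
have [a1 b1] := corner _ _ _ (Hx0 n); have [c1 d1] := corner _ _ _ (Hy0 n).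
have uv : 2 * (`|W| / 2 ^+ n) + 2 * (`|H| / 2 ^+ n) = 2 * (`|W| + `|H|) / 2 ^+ n by ring.
have := Hr _ _ _ _ _ _ a1 b1 c1 d1; rewrite uv => /(_ Hn) HJ.
have := Jq n; rewrite leNgt => /negP; apply.
apply: (@le_lt_trans _ _ (4 ^+ n * (4 * e * (2 * (`|W| + `|H|) / 2 ^+ n) ^+ 2))).
  by rewrite ler_pM2l ?exprn_gt0.
have -> : 4 ^+ n * (4 * e * (2 * (`|W| + `|H|) / 2 ^+ n) ^+ 2) = 16 * e * (`|W| + `|H|) ^+ 2.
  have -> : 4 ^+ n = (2 ^+ n) ^+ 2 :> R by rewrite -exprM mulnC exprM; congr (_ ^+ _); ring.
  by field; rewrite expf_neq0.
apply: (@lt_le_trans _ _ (32 * ((`|W| + `|H|) ^+ 2 + 1) * e)); last first.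
  by rewrite /e mulrC divfK// gt_eqF// mulr_gt0.
have s0 := sqr_ge0 (`|W| + `|H|); set s := _ ^+ 2 in s0 *.
have := mulr_ge0 s0 (ltW e0); lra.
Qed.

(** This is the integral of [f] from 0 along the real axis to Re w and then vertically to [w]. *)
Lemma cderiv_bdry : forall z, cderiv (fun w =>
  X 0 (complex.Re w) + 'i%C * (Y (complex.Re w) (complex.Im w) - Y (complex.Re w) 0)) z (f z).
Proof.
move=> z e e0; have e20 : 0 < e / 2 by rewrite divr_gt0.
have [r r0 Hr] := holo_cont _ fH z _ e20.
exists (r / 2) => [|h hr]; first by rewrite divr_gt0.
case: z Hr => x y; case: h hr => s t; rewrite -[in X in X -> _]/(s +i* t) => hr Hr /=.
set A := f _ in Hr *.
have sh : `|s| <= cmod (s +i* t) := Re_le_cmod (s +i* t).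
have th : `|t| <= cmod (s +i* t) := Im_le_cmod (s +i* t).
(* Moves the horizontal part of the increment from height 0 to height [y], so that only values of
   [f] close to [z] enter. *)
have J0 := bdry_eq0 x (x + s) 0 y.
have -> : X 0 (x + s) + 'i%C * (Y (x + s) (y + t) - Y (x + s) 0) -
    (X 0 x + 'i%C * (Y x y - Y x 0)) - A * (s +i* t) =
    ((X y (x + s) - A * (x + s)%:C) - (X y x - A * x%:C)) +
    'i%C * ((Y (x + s) (y + t) - A * (y + t)%:C) - (Y (x + s) y - A * y%:C)).
  have -> : s +i* t = s%:C + 'i%C * t%:C by exact: complexE.
  rewrite -[LHS]subr0 -J0 /bdry !rmorphD; ring.
have near u v : `|u - x| <= `|s| -> `|v - y| <= `|t| -> cmod (f (u +i* v) - A) <= e / 2.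
  move=> us vt; apply: Hr; rewrite (le_trans (le_cmod_ReIm _))//=; lra.
have btw (p q k : R) : Num.min p (p + q) <= k <= Num.max p (p + q) -> `|k - p| <= `|q|.
  have [pq|qp] := leP p (p + q) => /andP[t1 t2].
    by rewrite !ger0_norm; lra.
  by rewrite !ler0_norm; lra.
have lin k : rcderiv (fun x => A * x%:C) k A.
  have := rcderiv_quad A 0 0 k; rewrite mul0r addr0; congr (rcderiv _ _ _).
  by apply/funext => u; rewrite mul0r addr0.
apply: (le_trans (le_cmodD _ _)); rewrite cmodM cmod_i mul1r.
have H1 : cmod ((X y (x + s) - A * (x + s)%:C) - (X y x - A * x%:C)) <= e / 2 * `|x + s - x|.
  apply: (mvi (fun x => X y x - A * x%:C) (fun u => f (u +i* y) - A)) => u /btw uxs.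
    by apply: rcderivB => //; exact: HX.
  by apply: near => //; rewrite subrr normr0.
have H2 : cmod ((Y (x + s) (y + t) - A * (y + t)%:C) - (Y (x + s) y - A * y%:C)) <= e / 2 * `|y + t - y|.
  apply: (mvi (fun y => Y (x + s) y - A * y%:C) (fun u => f ((x + s) +i* u) - A)) => u /btw uxs.
    by apply: rcderivB => //; exact: HY.
  by apply: near => //; rewrite addrAC subrr add0r.
have Es (p q : R) : p + q - p = q by ring.
rewrite (Es x s) in H1; rewrite (Es y t) in H2.
apply: (le_trans (lerD H1 H2)); rewrite -mulrDr -mulrA ler_pM2l//; lra.
Qed.

End Goursat.

Lemma rcderiv_ex_primitive (f : R[i] -> R[i]) (a b : R[i]) : holo f ->
  exists X : R -> R[i], forall t, rcderiv X t (f (a + t%:C * b)).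
Proof.
move=> fH; pose g t := f (a + t%:C * b).
have C c : continuous (fun t => complex.Re (c * g t)).
  move=> t; have [d D] := fH (a + t%:C * b).
  exact: is_derive_continuous_at (rcderiv_Re c _ _ _ (cderiv_line _ _ _ _ _ D)).
have [U HU] := ex_primitive _ (C 1); have [V HV] := ex_primitive _ (C (- 'i%C)).
exists (fun t => U t +i* V t) => t; have := rcderiv_pair _ _ _ _ _ (HU t) (HV t).
by congr (rcderiv _ _ _); apply/eqP; rewrite eq_complex !cReM/= /g !(mul1r, mul0r, subr0, mulN1r, sub0r, oppr0, opprK) !eqxx.
Qed.

Lemma holo_primitive f : holo f -> exists F, forall z, cderiv F z (f z).
Proof.
move=> fH.
have ptX x y : x +i* y = (0 +i* y) + x%:C * 1 :> R[i].
  by rewrite mulr1; apply/eqP; rewrite eq_complex/= addr0 add0r !eqxx.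
have ptY x y : x +i* y = x%:C + y%:C * 'i%C :> R[i].
  by rewrite [LHS]complexE mulrC.
have [X HX] := choice (fun y => rcderiv_ex_primitive f (0 +i* y) 1 fH).
have [Y HY] := choice (fun x : R => rcderiv_ex_primitive f x%:C 'i%C fH).
eexists; apply: (cderiv_bdry f X Y fH) => [y x|x y].
  by rewrite ptX; exact: HX.
by rewrite ptY; exact: HY.
Qed.

Lemma cderiv_cint0 f z : holo f -> cderiv (cint0 f) z (f z).
Proof.
move=> fH; have [F dF] := holo_primitive _ fH.
suff -> : cint0 f = fun z => F z + - F 0.
  have := cderivD _ _ _ _ _ (dF z) (cderiv_cst (- F 0) z).
  by rewrite addr0.
apply/funext => {}z; rewrite /cint0.
have [->|z0] := eqVneq z 0; first by rewrite mul0r subrr.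
pose g (t : R) := f (t%:C * z).
(* Used with [c = 1] and [c = - i] for the two real integrals in [cint0]. Division by [z] undoes the
   factor of the chain rule. *)
have H (c : R[i]) : \int[lebesgue_measure]_(t in `[0, 1]) complex.Re (c * g t) =
    complex.Re (c * (z^-1 * (F z - F 0))).
  have D t : is_derive t 1 (fun t : R => complex.Re (c / z * F (0 + t%:C * z))) (complex.Re (c * g t)).
    have -> : c * g t = c / z * (f (0 + t%:C * z) * z) by rewrite add0r /g; field.
    by apply: rcderiv_Re; apply: cderiv_line.
  rewrite (Rintegral_primitive _ _ _ _ ltr01 _ D).
    by rewrite mul1r mul0r !add0r -cReB; congr complex.Re; ring.
  move=> t; have [d Dg] := fH (0 + t%:C * z).
  have := rcderiv_Re c _ _ _ (cderiv_line _ _ _ _ _ Dg).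
  by under [X in is_derive _ _ X]eq_fun do rewrite add0r; exact: is_derive_continuous_at.
have ImE (w : R[i]) : complex.Re (- 'i%C * w) = complex.Im w.
  by rewrite cReM/= oppr0 mul0r sub0r mulN1r opprK.
have KE (u v : R) : u = complex.Re (z^-1 * (F z - F 0)) ->
    v = complex.Im (z^-1 * (F z - F 0)) -> z * (u +i* v) = F z - F 0.
  move=> -> ->; have E (w : R[i]) : complex.Re w +i* complex.Im w = w by case: w.
  by rewrite E; field.
apply: KE.
  by rewrite -[X in complex.Re X]mul1r -H; apply: eq_Rintegral => t _; rewrite mul1r.
by rewrite -ImE -H; apply: eq_Rintegral => t _; rewrite ImE.
Qed.

End Primitives.

(** * Maximum principle and growth in terms of the proximity function *)

Section MaximumPrinciple.
Context {R : realType}.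
Implicit Types (f g K : R[i] -> R[i]) (z w : R[i]).

Lemma cexp_2pi z : cexp (z + (0 +i* (2 * pi))) = cexp z :> R[i].
Proof.
by rewrite /cexp cReD cImD/= addr0 mulr_natl /polar cosD2pi sinD2pi.
Qed.

(* [exp] turns the circles about [z] into vertical lines; if [F] is a primitive
   of [K (z + exp w)], then [F (w + 2 i pi) - F w] is a constant, equal to
   [2 i pi K z] because [K] is continuous at [z]. *)
Lemma Re_mean_value K z (r : R) : holo K -> 0 < r ->
  exists t, complex.Re (K (z + polar r t)) = complex.Re (K z).
Proof.
move=> KH r0; pose G w := K (z + cexp w).
have GH : holo G.
  apply: (holo_comp K (fun w => z + cexp w)) => //.
  by apply: holoD; [exact: holo_cst | exact: holo_cexp].
have [F dF] := holo_primitive _ GH.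
pose per : R[i] := 0 +i* (2 * pi).
have Gper w : G (w + per) = G w by rewrite /G cexp_2pi.
(* The integral of [G] over one period on the line of abscissa [s], that is, over the circle of
   radius exp s about [z]. Periodicity of [G] makes its derivative in [s] vanish. *)
pose D (s : R) := F (per + s%:C * 1) - F (0 + s%:C * 1).
have Dcst s s' : D s = D s'.
  apply/eqP; rewrite -subr_eq0 -cmod_eq0; apply/eqP/le_anti; rewrite cmod_ge0 andbT.
  rewrite -[leRHS](mul0r `|s - s'|).
  apply: (mvi D (fun s => G (per + s%:C * 1) * 1 - G (0 + s%:C * 1) * 1)) => t _.
    by apply: rcderivB; apply: cderiv_line; exact: dF.
  by rewrite [per + _]addrC Gper add0r subrr cmod0.
have pi0 := @pi_gt0 R.
have mv s : exists t, complex.Re (- 'i%C * D s) = complex.Re (K (z + polar (expR s) t)) * (2 * pi).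
  have dRe (t : R) : is_derive t 1 (fun t : R => complex.Re (- 'i%C * F (s%:C + t%:C * 'i%C)))
      (complex.Re (K (z + polar (expR s) t))).
    have -> : K (z + polar (expR s) t) = - 'i%C * (G (s%:C + t%:C * 'i%C) * 'i%C).
      have -> : s%:C + t%:C * 'i%C = s +i* t by rewrite [RHS]complexE mulrC.
      rewrite [G _ * _]mulrC mulrA mulNr -expr2 sqr_i opprK mul1r /G.
      by rewrite -[polar _ _]/(cexp (s +i* t)).
    by apply: rcderiv_Re; apply: cderiv_line; exact: dF.
  have p20 : 0 < 2 * pi :> R by rewrite mulr_gt0.
  have [|t _ tE] := @MVT _ _ _ _ _ p20 (fun t _ => dRe t).
    by apply: continuous_subspaceT; exact: is_derive_continuous dRe.
  exists t; rewrite -[2 * pi]subr0 -tE -cReB -mulrBr /D.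
  congr (complex.Re (_ * (F _ - F _))).
    by apply/eqP; rewrite eq_complex/=; apply/andP; split; apply/eqP; ring.
  by apply/eqP; rewrite eq_complex/=; apply/andP; split; apply/eqP; ring.
(* The common mean of Re K over all circles about [z], attained on each of them by the real mean
   value theorem. Small circles identify it with Re (K z). *)
pose A := complex.Re (- 'i%C * D 0) / (2 * pi).
have mvA s : exists t, complex.Re (K (z + polar (expR s) t)) = A.
  have [t tE] := mv s; exists t.
  by rewrite /A (Dcst 0 s) tE mulfK// mulf_neq0// gt_eqF.
have AE : A = complex.Re (K z).
  apply/eqP; rewrite -subr_eq0 -normr_eq0; apply/negP => /negP; rewrite -normr_gt0 normr_id => A0.
  have A20 : 0 < `|A - complex.Re (K z)| / 2 by rewrite divr_gt0.
  have [e e0 He] := holo_cont _ KH z _ A20.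
  have [t tE] := mvA (ln e).
  have := He (z + polar (expR (ln e)) t).
  rewrite [z + _]addrC addrK cmod_polar ?expR_ge0// lnK// => /(_ (lexx _)).
  rewrite leNgt => /negP; apply.
  rewrite lnK// in tE.
  have := Re_le_cmod (K (z + polar e t) - K z).
  rewrite cReB tE [polar e t + z]addrC => H; lra.
have [t tE] := mvA (ln r); exists t.
by rewrite lnK// in tE; rewrite tE.
Qed.

(** The parameter space is left free: it is a line for functions on a circle and a plane for polar
    coordinates of a disc. *)
Lemma continuous_cmod_comp (T : topologicalType) g (u v : T -> R) (q : T) : holo g ->
  {for q, continuous u} -> {for q, continuous v} ->
  {for q, continuous (fun x => cmod (g (u x +i* v x)))}.
Proof.
move=> gH /cvgrPdist_le uc /cvgrPdist_le vc; apply/cvgrPdist_le => e e0.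
have [r r0 Hr] := holo_cont _ gH (u q +i* v q) _ e0.
have r20 : 0 < r / 2 by rewrite divr_gt0.
near=> x.
have -> : `|cmod (g (u q +i* v q)) - cmod (g (u x +i* v x))| <= e =
    (`|cmod (g (u x +i* v x)) - cmod (g (u q +i* v q))| <= e) by rewrite distrC.
have H : cmod (g (u x +i* v x) - g (u q +i* v q)) <= e.
  apply: Hr; rewrite (le_trans (le_cmod_ReIm _))//= (splitr r).
  apply: lerD; rewrite distrC.
    by near: x; exact: uc.
  by near: x; exact: vc.
have H1 := ge_cmodB (g (u x +i* v x)) (g (u q +i* v q)).
have H2 := ge_cmodB (g (u q +i* v q)) (g (u x +i* v x)).
rewrite cmodBC in H2.
by rewrite ler_norml; apply/andP; split; lra.
Unshelve. all: by end_near. Qed.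

Lemma continuous_cmod_polar (g : R[i] -> R[i]) (r : R) : holo g ->
  continuous (fun t => cmod (g (polar r t))).
Proof.
move=> gH t; apply: (continuous_cmod_comp R g (fun t => r * cos t) (fun t => r * sin t)) => //.
  by apply: cvgM; [exact: cvg_cst | exact: continuous_cos].
by apply: cvgM; [exact: cvg_cst | exact: continuous_sin].
Qed.

Lemma cmodD_sqr z w : cmod (z + w) ^+ 2 =
  cmod z ^+ 2 + 2 * complex.Re (conjc z * w) + cmod w ^+ 2.
Proof.
by case: z => a b; case: w => c d; rewrite !sqr_cmod/=; ring.
Qed.

(* At an interior maximum of the strictly subharmonic function
   [|g| + d |w|^2], the mean value property fails. *)
Lemma maximum_principle g (r : R) : holo g -> 0 < r ->
  (forall w, cmod w = r -> cmod (g w) <= 1) ->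
  forall z, cmod z <= r -> cmod (g z) <= 1.
Proof.
move=> gH r0 Hr z0 z0r; rewrite leNgt; apply/negP => g1.
(* So small that on the circle |w| = r the perturbed function is at most 1 + (|g z0| - 1) / 2, below
   its value at [z0]; its maximum is therefore interior. *)
pose d := (cmod (g z0) - 1) / (2 * r ^+ 2).
have r20 : 0 < r ^+ 2 by rewrite exprn_gt0.
have d0 : 0 < d by rewrite divr_gt0 ?subr_gt0 ?mulr_gt0.
have dr : d * r ^+ 2 = (cmod (g z0) - 1) / 2 by rewrite /d; field; rewrite gt_eqF.
pose v w := cmod (g w) + d * cmod w ^+ 2.
(* In polar coordinates the disc becomes a compact rectangle of [R * R]. *)
pose V (q : R * R) := cmod (g (polar q.1 q.2)) + d * q.1 ^+ 2.
have Vc : continuous V.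
  move=> q; apply: cvgD.
    apply: (continuous_cmod_comp _ g (fun q : R * R => q.1 * cos q.2) (fun q : R * R => q.1 * sin q.2)) => //.
      apply: cvgM; first exact: cvg_fst.
      by apply: (continuous_comp (f := snd) (g := cos)); [exact: cvg_snd | exact: continuous_cos].
    apply: cvgM; first exact: cvg_fst.
    by apply: (continuous_comp (f := snd) (g := sin)); [exact: cvg_snd | exact: continuous_sin].
  apply: cvgM; first exact: cvg_cst.
  by apply: cvgM; exact: cvg_fst.
have pi0 := @pi_gt0 R.
have cpt := compact_setX (@segment_compact R 0 r) (@segment_compact R 0 (2 * pi)).
have [|[rho th]] := compact_EVT_max _ cpt (continuous_subspaceT Vc).
  by exists (0, 0); split; rewrite /= in_itv/= lexx ?ltW// mulr_gt0.
rewrite inE => -[/=]; rewrite !in_itv/= => /andP[rho0 rhor] _ Vmax.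
pose zs : R[i] := polar rho th.
have zsE : cmod zs = rho by rewrite cmod_polar.
have vmax w : cmod w <= r -> v w <= v zs.
  move=> wr; have [t [t2 wE]] := polar_surj w.
  have := Vmax (cmod w, t); rewrite inE/= => /(_ _)/wrap[].
    by split; rewrite /= in_itv/= ?cmod_ge0.
  by rewrite /V/= -wE -/zs /v zsE.
have [rhoE|rhoN] := eqVneq rho r.
  have := vmax z0 z0r; have := Hr zs; rewrite /v zsE rhoE => /(_ erefl).
  have := mulr_ge0 (ltW d0) (sqr_ge0 (cmod z0)); lra.
have s0 : 0 < r - rho by rewrite subr_gt0 lt_neqAle rhoN.
have [c [c1 cE]] := unit_rotation (g zs).
(* Since |w|^2 = |zs|^2 + 2 Re (conj zs (w - zs)) + |w - zs|^2, one has v w >= Re (K w) + d |zs|^2 +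
   d |w - zs|^2, while v zs = Re (K zs) + d |zs|^2. A point [w] on a circle about [zs] with Re (K w)
   = Re (K zs) then has v w > v zs. *)
pose K w := c * g w + (2 * d)%:C * conjc zs * (w + - zs).
have KH : holo K.
  apply: holoD; first by apply: holoM => //; exact: holo_cst.
  apply: holoM; first exact: holo_cst.
  by apply: holoD; [exact: holo_id | exact: holo_cst].
have [t tE] := Re_mean_value K zs _ KH s0.
set w := zs + polar (r - rho) t in tE.
have wr : cmod w <= r.
  rewrite (le_trans (le_cmodD _ _))// zsE cmod_polar ?(ltW s0)//; lra.
have := vmax w wr; rewrite leNgt => /negP; apply.
rewrite /v /w cmodD_sqr -/w.
move: tE; rewrite /K subrr mulr0 addr0 cE /w [zs + _ - zs]addrAC subrr add0r -/w.
rewrite cReD -mulrA cReZ => tE.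
have cw : complex.Re (c * g w) <= cmod (g w).
  by rewrite (le_trans (ler_Re_cmod _))// cmodM c1 mul1r.
have ds : 0 < d * cmod (polar (r - rho) t) ^+ 2.
  by rewrite mulr_gt0// exprn_gt0// cmod_polar ?ltW.
set X := complex.Re (conjc zs * _) in tE *; lra.
Qed.

End MaximumPrinciple.

(** * Pointwise bounds from the proximity function *)

Section Proximity.
Context {R : realType}.
Implicit Types (f : R[i] -> R[i]) (z w u : R[i]) (x y t : R) (N M : nat).

Lemma logp_ge0 x : 0 <= logp x.
Proof. by rewrite /logp le_max lexx. Qed.

Lemma ln_le_logp x : ln x <= logp x.
Proof. by rewrite /logp le_max lexx orbT. Qed.

Lemma le_expR_logp x : 0 <= x -> x <= expR (logp x).
Proof.
rewrite le_eqVlt => /predU1P[<-|x0]; first exact: expR_ge0.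
by rewrite -{1}(lnK x0) ler_expR ln_le_logp.
Qed.

Lemma logpE x : logp x = ln (Num.max 1 x).
Proof.
rewrite /logp; have [x1|x1] := leP x 1.
  by rewrite max_l ?ln1// ln_le0.
by rewrite max_r// ln_ge0// ltW.
Qed.

(** With A, B >= 1, ln (A / B) <= A / B - 1 = (A - B) / B, which is at most A - B when A >= B. This
    makes log+ |f| continuous at the zeros of [f] too. *)
Lemma logp_lipschitz x y : `|logp x - logp y| <= `|x - y|.
Proof.
suff H (a b : R) : logp a - logp b <= `|a - b|.
  by have := H x y; have := H y x; rewrite [`|y - x|]distrC ler_norml => *; apply/andP; split; lra.
rewrite !logpE; set A := Num.max 1 a; set B := Num.max 1 b.
have A1 : 1 <= A by rewrite le_max lexx.
have B1 : 1 <= B by rewrite le_max lexx.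
have A0 : 0 < A by exact: lt_le_trans A1.
have B0 : 0 < B by exact: lt_le_trans B1.
have AB : A - B <= `|a - b|.
  rewrite lerBlDr /A ge_max; apply/andP; split; first by rewrite (le_trans B1)// lerDr.
  have bB : b <= B by rewrite le_max lexx orbT.
  have := ler_norm (a - b); lra.
rewrite -ln_div ?posrE// (_ : A / B = 1 + (A / B - 1)); last by rewrite addrC subrK.
rewrite (le_trans (le_ln1Dx _)) ?ltrBrDr ?addNr ?divr_gt0//.
have -> : A / B - 1 = (A - B) / B by rewrite mulrBl divff// gt_eqF.
have [AB0|AB0] := leP (A - B) 0.
  by rewrite (le_trans _ (normr_ge0 _))// mulr_le0_ge0// invr_ge0 ltW.
by rewrite (le_trans _ AB)// ler_pdivrMr// ler_peMr// ltW.
Qed.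

Lemma continuous_logp_polar f (r : R) : holo f ->
  continuous (fun t => logp (cmod (f (polar r t)))).
Proof.
move=> fH t; have /cvgrPdist_le H := continuous_cmod_polar f r fH t.
apply/cvgrPdist_le => e e0; near=> s.
by rewrite (le_trans (logp_lipschitz _ _))//; near: s; exact: H.
Unshelve. all: by end_near. Qed.

(** Compactness in its near-covering form turns a local choice of [d] into one valid on the whole
    segment. *)
Lemma unif_continuous_segment (g : R -> R) (a b e : R) : continuous g -> 0 < e ->
  exists2 d, 0 < d & forall x y, a <= x <= b -> `|y - x| <= d -> `|g y - g x| <= e.
Proof.
move=> gc e0.
have cov := (compact_near_coveringP _).1 (@segment_compact R a b).
have e20 : 0 < e / 2 by rewrite divr_gt0.
have H : \forall d \near ((0:R)^'+),
    `[a, b]%classic `<=` (fun x => forall y, `|y - x| <= d -> `|g y - g x| <= e).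
  apply: (cov R ((0:R)^'+)
    (fun d x => forall y, `|y - x| <= d -> `|g y - g x| <= e)) => x _.
  have /cvgrPdist_le/(_ _ e20)/nbhs_ballP[r /= r0 Hr] := gc x.
  have r20 : 0 < r / 2 by rewrite divr_gt0.
  exists (ball x (r / 2), [set d | d < r / 2]) => /=.
    by split; [exact: nbhsx_ballx | exact: nbhs_right_lt].
  move=> [x' d]/= [xx' dr] y yx'.
  rewrite -ball_normE/= in xx'.
  have H1 : `|g x - g x'| <= e / 2.
    by apply: Hr; rewrite -ball_normE/= (lt_trans xx')// ltr_pdivrMr// ltr_pMr// ltr1n.
  have H2 : `|g x - g y| <= e / 2.
    apply: Hr; rewrite -ball_normE/= -(subrK x' x) -addrA (le_lt_trans (ler_normD _ _))//.
    by rewrite [ltRHS](splitr r) ltr_leD// distrC (le_trans yx')// ltW.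
  rewrite (splitr e) -(subrK (g x) (g y)) -addrA (le_trans (ler_normD _ _))// lerD//.
  by rewrite distrC.
have [d [d0 Hd]] : exists d : R, 0 < d /\ forall x, a <= x <= b ->
    forall y, `|y - x| <= d -> `|g y - g x| <= e.
  near (0:R)^'+ => d; exists d; split => //.
  move=> x xab; have : `[a, b]%classic x by rewrite /= in_itv.
  by move: x {xab}; near: d; exact: H.
by exists d => // x y /Hd; apply.
Unshelve. all: by end_near. Qed.

Lemma ex_arc N t (l : R) : (0 < N)%N -> 0 <= t <= N%:R * l ->
  exists j : 'I_N, j%:R * l <= t <= j.+1%:R * l.
Proof.
elim: N => [//|N IH] _ /andP[t0 tN].
case: N IH tN => [_ tN|N IH tN].
  by exists ord0; rewrite /= mul0r t0.
have [tN'|/ltW tN'] := leP t (N.+1%:R * l).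
  have [|j jt] := IH isT; first by rewrite t0.
  by exists (widen_ord (leqnSn _) j).
by exists ord_max; rewrite /= tN'.
Qed.

Lemma riemann_sum_le (g : R -> R) (l : R) N : 0 < l -> continuous g ->
  (forall j s, (j < N)%N -> j%:R * l <= s <= j.+1%:R * l -> g (j%:R * l) <= g s + 1) ->
  (0 < N)%N ->
  \sum_(j < N) g (j%:R * l) * l <=
    \int[lebesgue_measure]_(s in `[0, N%:R * l]) g s + N%:R * l.
Proof.
move=> l0 gc H N0; have [G dG] := ex_primitive _ gc.
have Nl : 0 < N%:R * l by rewrite mulr_gt0// ltr0n.
rewrite (Rintegral_primitive _ _ _ _ Nl gc dG).
suff S n : (n <= N)%N -> \sum_(j < n) g (j%:R * l) * l <= G (n%:R * l) - G 0 + n%:R * l.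
  exact: S.
elim: n => [|n IH] nN; first by rewrite big_ord0 mul0r subrr addr0.
rewrite big_ord_recr/= -natr1 mulrDl mul1r.
have {}IH := IH (ltnW nN).
have nl : n%:R * l < n%:R * l + l by rewrite ltrDl.
have [|c cI cE] := @MVT _ G g _ _ nl (fun x _ => dG x).
  by apply: continuous_subspaceT; exact: is_derive_continuous dG.
have := H n c nN; rewrite -natr1 mulrDl mul1r.
move: cI; rewrite in_itv/= => /andP[/ltW c1 /ltW c2]; rewrite c1 c2 => /(_ isT) Hc.
have : g (n%:R * l) * l <= (g c + 1) * l by rewrite ler_pM2r.
rewrite addrAC subrr add0r in cE; rewrite mulrDl mul1r -cE; lra.
Qed.

(** A truncation of 1 / (1 - q u), whose real part on |u| = 1 is half of 1 plus the Poisson kernel.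
    Truncating keeps it entire in [u]. *)
Definition geom (q : R) M u : R[i] := \sum_(m < M) (q%:C * u) ^+ m.

Lemma holo_geom q M (a : R[i]) : holo (fun w => geom q M (w * a)).
Proof.
apply: holo_sum => m.
rewrite (_ : (fun w => _) = fun w => ('X^m : {poly R[i]}).[q%:C * (w * a)]).
  apply: (holo_comp (fun z => ('X^m : {poly R[i]}).[z])); first exact: holo_poly.
  apply: holoM; first exact: holo_cst.
  by apply: holoM; [exact: holo_id | exact: holo_cst].
by apply/funext => w; rewrite hornerXn.
Qed.

(** Uniform in [q] and [M]: on the half disc the majorant is then controlled by the sum of its
    weights alone. *)
Lemma cmod_geom_le2 q M u : 0 <= q <= 1 -> cmod u <= 1 / 2 -> cmod (geom q M u) <= 2.
Proof.
move=> /andP[q0 q1] u2; rewrite (le_trans (cmod_sum _ _ _ _))//.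
apply: (@le_trans _ _ (\sum_(m < M) (1 / 2) ^+ m)).
  apply: ler_sum => m _; rewrite cmodX lerXn2r ?nnegrE ?cmod_ge0//.
  by rewrite cmodM cmod_real ger0_norm// (le_trans _ u2)// ler_piMl// cmod_ge0.
suff -> : \sum_(m < M) (1 / 2 : R) ^+ m = 2 - 2 * (1 / 2) ^+ M.
  by rewrite gerBl mulr_ge0// exprn_ge0.
elim: M => [|M IH]; first by rewrite big_ord0 expr0; ring.
by rewrite big_ord_recr/= IH exprSr; field.
Qed.

(** With D = 1 - q u, Re (1 / D) = Re D / |D|^2 >= (1 - q) / |D|^2. The truncation error is at most
    (1 - q) / 8, and |D| <= 2 makes this at most half of the main term. *)
Lemma Re_geom_ge q M u : 0 < q < 1 -> q ^+ M <= (1 - q) ^+ 2 / 8 -> cmod u = 1 ->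
  (1 - q) / (2 * cmod (1 - q%:C * u) ^+ 2) <= complex.Re (geom q M u).
Proof.
move=> /andP[q0 q1] qM u1; set D := 1 - q%:C * u; pose d := cmod D.
have qu : cmod (q%:C * u) = q by rewrite cmodM cmod_real u1 mulr1 ger0_norm// ltW.
have d1 : 1 - q <= d by rewrite /d /D -{1}qu -{1}(@cmod1 R) ge_cmodB.
have d2 : d <= 2 by rewrite /d /D (le_trans (le_cmodB _ _))// cmod1 qu; lra.
have q10 : 0 < 1 - q by rewrite subr_gt0.
have d0 : 0 < d by exact: lt_le_trans d1.
have D0 : D != 0 by rewrite -cmod_gt0.
have gE : geom q M u = D^-1 - (q%:C * u) ^+ M * D^-1.
  have := subrX1 (q%:C * u) M; rewrite -/(geom q M u) => H.
  have -> : geom q M u = - ((q%:C * u - 1) * geom q M u) * D^-1 by rewrite /D; field.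
  by rewrite -H; ring.
have ReV : complex.Re D^-1 = complex.Re D / d ^+ 2.
  have -> : D^-1 = (d ^- 2)%:C * conjc D.
    apply: (mulfI D0); rewrite divff// mulrCA.
    have -> : D * conjc D = (d ^+ 2)%:C.
      by rewrite sqr_cmod; case: (D) => a b /=; apply/eqP; rewrite eq_complex/=; apply/andP; split; apply/eqP; ring.
    by rewrite -rmorphM/= mulVf// expf_neq0// gt_eqF.
  by rewrite cReZ mulrC; case: (D).
have ReD : 1 - q <= complex.Re D.
  by rewrite /D cReB/= lerB// (le_trans (ler_Re_cmod _))// qu.
have err : complex.Re ((q%:C * u) ^+ M * D^-1) <= (1 - q) / 8.
  rewrite (le_trans (ler_Re_cmod _))// cmodM cmodX qu cmodV -/d.
  rewrite ler_pdivrMr// (le_trans qM)//.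
  have -> : (1 - q) ^+ 2 / 8 = (1 - q) / 8 * (1 - q) by field.
  by rewrite ler_wpM2l// divr_ge0// ltW.
have dd : 0 < d ^+ 2 by rewrite exprn_gt0.
have d4 : d ^+ 2 <= 4.
  by rewrite (_ : 4 = 2 ^+ 2 :> R); [rewrite lerXn2r// nnegrE ltW | ring].
rewrite gE cReB ReV -/d.
have E1 : (1 - q) / (2 * d ^+ 2) <= complex.Re D / d ^+ 2 - (1 - q) / (2 * d ^+ 2).
  have -> : complex.Re D / d ^+ 2 - (1 - q) / (2 * d ^+ 2) =
     (1 - q) / (2 * d ^+ 2) + (complex.Re D - (1 - q)) / d ^+ 2 by field; rewrite gt_eqF.
  by rewrite lerDl divr_ge0 ?subr_ge0// ltW.
apply: (le_trans E1); rewrite lerB// (le_trans err)// ler_pM2l//.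
by rewrite lef_pV2 ?posrE ?mulr_gt0//; lra.
Qed.

Lemma cmod_polar1B t : cmod (1 - polar 1 t) <= `|t|.
Proof.
have cE (s : R) : cexp (0 + s%:C * 'i%C) = polar 1 s :> R[i].
  by rewrite add0r /cexp cReZ cImZ/= mulr0 mulr1 expR0.
have := @mvi _ (fun s : R => cexp (0 + s%:C * 'i%C)) (fun s : R => cexp (0 + s%:C * 'i%C) * 'i%C) 1 0 t.
rewrite !cE mul1r subr0 cmodBC.
have -> : polar 1 0 = 1 :> R[i] by rewrite /polar cos0 sin0 mulr1 mulr0.
apply => s _; first by apply: cderiv_line; exact: cderiv_cexp.
by rewrite cE cmodM cmod_i mulr1 cmod_polar.
Qed.

(** For q = 1 - 1/N and an angle at most 2 pi / N < 8 / N, |1 - q u| <= 9 / N; inserted in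
    [Re_geom_ge] this gives N / (2 * 81). *)
Lemma Re_geom_arc N M t : (1 < N)%N ->
  (1 - N%:R^-1 : R) ^+ M <= N%:R^-1 ^+ 2 / 8 ->
  0 <= t <= 2 * pi / N%:R ->
  N%:R / 162 <= complex.Re (geom (1 - N%:R^-1) M (polar 1 t)).
Proof.
move=> N1 qM /andP[t0 tN]; pose n : R := N%:R^-1.
have N0 : 0 < N%:R :> R by rewrite ltr0n (ltn_trans _ N1).
have n0 : 0 < n by rewrite invr_gt0.
have n1 : n < 1 by rewrite invf_lt1// ltr1n.
have q01 : 0 < 1 - n < 1 by rewrite subr_gt0 n1 gtrBl.
have := Re_geom_ge (1 - n) M (polar 1 t) q01.
rewrite opprB addrCA subrr addr0 => /(_ qM (cmod_polar _ _ ler01)); apply: le_trans.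
set d := cmod _.
have pi4 : 2 * pi < 8 :> R by have := @pihalf_lt2 R; lra.
have d9 : d <= 9 * n.
  rewrite /d (_ : 1 - (1 - n)%:C * polar 1 t = n%:C + (1 - n)%:C * (1 - polar 1 t)); last first.
    by rewrite rmorphB/= rmorph1; ring.
  rewrite (le_trans (le_cmodD _ _))// cmodM !cmod_real !ger0_norm ?subr_ge0 ?(ltW n1) ?(ltW n0)//.
  have -> : 9 * n = n + 8 * n by ring.
  rewrite lerD2l (@le_trans _ _ (1 * cmod (1 - polar 1 t : R[i])))//.
    by rewrite ler_wpM2r ?cmod_ge0// gerBl ltW.
  rewrite mul1r (le_trans (cmod_polar1B _))// ger0_norm// (le_trans tN)//.
  by rewrite ler_wpM2r// ltW.
have d0 : 0 < d.
  rewrite (@lt_le_trans _ _ n)// /d.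
  have := ge_cmodB 1 ((1 - n)%:C * polar 1 t : R[i]).
  rewrite cmodM cmod1 cmod_real cmod_polar// mulr1 ger0_norm ?subr_ge0 ?(ltW n1)//.
  by rewrite opprB addrCA subrr addr0.
have dd : d ^+ 2 <= 81 * n ^+ 2.
  have -> : 81 * n ^+ 2 = (9 * n) ^+ 2 by ring.
  by rewrite lerXn2r// nnegrE ?mulr_ge0 ?ltW.
have -> : N%:R / 162 = n / (2 * (81 * n ^+ 2)).
  by rewrite /n; field; rewrite gt_eqF.
rewrite ler_pM2l// lef_pV2 ?posrE ?mulr_gt0 ?exprn_gt0//; lra.
Qed.

(* Compared with the sharp Poisson-Jensen bound, the harmonic majorant of
   [log+ |f|] is replaced by the real part of a polynomial: a sum of truncated
   geometric series, one for each of N equal arcs of the circle, whose real part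
   is nonnegative on the circle and at least of order N on its own arc. *)
Lemma cmod_le_proximity f (r : R) z : holo f -> 0 < r -> cmod z <= r / 2 ->
  cmod (f z) <= expR (324 * (proximity f r + 2)).
Proof.
move=> fH r0 zr; pose g t := logp (cmod (f (polar r t))).
have gc : continuous g by exact: continuous_logp_polar.
have pi0 := @pi_gt0 R; have p20 : 0 < 2 * pi :> R by rewrite mulr_gt0.
have [d d0 Hd] := unif_continuous_segment g 0 (2 * pi) 1 gc ltr01.
(* Fine enough that [g] varies by at most 1 on each arc; the offset 2 ensures 1 < N, hence 0 < q. *)
pose N := (Num.bound (2 * pi / d)).+2.
have N0 : 0 < N%:R :> R by rewrite ltr0n.
have N00 : N%:R != 0 :> R by rewrite gt_eqF.
pose l : R := 2 * pi / N%:R; have l0 : 0 < l by rewrite divr_gt0.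
have ld : l <= d.
  rewrite ler_pdivrMr// [d * _]mulrC -ler_pdivrMr// ltW// (lt_le_trans (archi_boundP _))//.
    exact: divr_ge0 (ltW p20) (ltW d0).
  by rewrite ler_nat; exact: leqW (leqnSn _).
have Nl : N%:R * l = 2 * pi by rewrite /l; field.
pose q : R := 1 - N%:R^-1.
have n1 : N%:R^-1 < 1 :> R by rewrite invf_lt1// ltr1n.
have q01 : 0 < q < 1 by rewrite subr_gt0 n1 gtrBl invr_gt0.
have [q0 q1] := andP q01.
have [M qM] : exists M, q ^+ M <= N%:R^-1 ^+ 2 / 8.
  have /cvg_expr/cvgrPdist_le : `|q| < 1 by rewrite ger0_norm// ltW.
  have e0 : 0 < N%:R^-1 ^+ 2 / 8 :> R by rewrite divr_gt0// exprn_gt0// invr_gt0.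
  move=> /(_ _ e0)[M _ /(_ M (leqnn _))] /=; rewrite sub0r normrN => H.
  by exists M; exact: le_trans (ler_norm _) H.
pose G j := g (j%:R * l) + 1.
have G0 j : 0 <= G j by rewrite addr_ge0// logp_ge0.
(* The weight 162 / N cancels the lower bound N / 162, so the j-th real part is at least [G j], and
   thus at least [g], on the j-th arc. *)
pose P w := \sum_(j < N) (162 / N%:R * G j)%:C * geom q M (w * (polar r (j%:R * l))^-1).
have PH : holo P.
  by apply: holo_sum => j; apply: holoM; [exact: holo_cst | exact: holo_geom].
have osc j s : (j < N)%N -> j%:R * l <= s <= j.+1%:R * l ->
    `|g s - g (j%:R * l)| <= 1.
  move=> jN; rewrite -natr1 mulrDl mul1r => /andP[s1 s2]; apply: Hd.
    by rewrite mulr_ge0 ?(ltW l0)//= -Nl ler_wpM2r ?(ltW l0)// ler_nat ltnW.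
  rewrite ger0_norm ?subr_ge0//; lra.
have polV t : (polar r t)^-1 = polar r^-1 (- t) :> R[i].
  have pne : polar r t != 0 :> R[i] by rewrite -cmod_gt0 cmod_polar// ltW.
  apply: (mulfI pne); rewrite divff// -polarD divff ?gt_eqF// subrr.
  by rewrite /polar cos0 sin0 mulr1 mulr0.
have major t : 0 <= t <= 2 * pi -> g t <= complex.Re (P (polar r t)).
  move=> /andP[t0 t2]; have [|j /andP[jt tj]] := @ex_arc N t l isT.
    by rewrite Nl t0.
  rewrite /P cRe_sum (bigD1 j)//=.
  have uE i : polar r t / polar r (i%:R * l) = polar 1 (t - i%:R * l) :> R[i].
    by rewrite polV -polarD divff// gt_eqF.
  have Hj : g t <= complex.Re ((162 / N%:R * G j)%:C * geom q M (polar r t / polar r (j%:R * l))).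
    rewrite uE cReZ.
    have H1 : N%:R / 162 <= complex.Re (geom q M (polar 1 (t - j%:R * l))).
      by apply: Re_geom_arc => //; rewrite subr_ge0 jt/= lerBlDl -/l; move: tj; rewrite -natr1 mulrDl mul1r.
    apply: (@le_trans _ _ (162 / N%:R * G j * (N%:R / 162))); last first.
      by rewrite ler_wpM2l// mulr_ge0// divr_ge0// ltW.
    have -> : 162 / N%:R * G j * (N%:R / 162) = G j by field.
    have := osc j t (ltn_ord j); rewrite jt tj => /(_ isT); rewrite ler_norml => /andP[_].
    by rewrite /G; lra.
  rewrite (le_trans Hj)// lerDl sumr_ge0// => i _.
  rewrite uE cReZ mulr_ge0//; first by rewrite mulr_ge0// divr_ge0// ltW.
  have qM' : q ^+ M <= (1 - q) ^+ 2 / 8 by rewrite /q opprB addrCA subrr addr0.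
  apply: (le_trans _ (Re_geom_ge q M _ q01 qM' (cmod_polar _ _ ler01))).
  by rewrite divr_ge0 ?subr_ge0 ?(ltW q1)// mulr_ge0// sqr_ge0.
(* 324 is 162 times the bound 2 for [geom]. Of the summand 2, one unit is the [+ 1] in [G] and the
   other the error of the Riemann sum. *)
have PzB : complex.Re (P z) <= 324 * (proximity f r + 2).
  rewrite (le_trans (ler_Re_cmod _))// (le_trans (cmod_sum _ _ _ _))//.
  apply: (@le_trans _ _ (\sum_(j < N) 162 / N%:R * G j * 2)).
    apply: ler_sum => j _; rewrite cmodM cmod_real ger0_norm; last first.
      by rewrite mulr_ge0// divr_ge0// ltW.
    apply: ler_wpM2l; first by rewrite mulr_ge0// divr_ge0// ltW.
    apply: cmod_geom_le2; first by rewrite !ltW.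
    by rewrite cmodM cmodV cmod_polar ?(ltW r0)// ler_pdivrMr// mulrAC mul1r.
  have -> : \sum_(j < N) 162 / N%:R * G j * 2 =
      324 * ((2 * pi)^-1 * (\sum_(j < N) g (j%:R * l) * l) + 1).
    have -> : \sum_(j < N) 162 / N%:R * G j * 2 = \sum_(j < N) ((324 / (2 * pi)) * (g (j%:R * l) * l) + 324 / N%:R).
      apply: eq_bigr => j _; rewrite /G /l.
      have E (c n x : R) : c != 0 -> n != 0 ->
          162 / n * (x + 1) * 2 = 324 / c * (x * (c / n)) + 324 / n.
        by move=> c0 n0; field; rewrite c0 n0.
      by apply: E; rewrite // gt_eqF.
    rewrite big_split/= -mulr_sumr sumr_const card_ord -[_ *+ N]mulr_natl.
    have E (c n x : R) : c != 0 -> n != 0 -> 324 / c * x + n * (324 / n) = 324 * (c^-1 * x + 1).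
      by move=> c0 n0; field; rewrite c0 n0.
    by apply: E; rewrite // gt_eqF.
  rewrite ler_pM2l// /proximity -lerBrDr.
  have -> : (2 * pi)^-1 * \int[lebesgue_measure]_(theta in `[0, 2 * pi]) logp (cmod (f (polar r theta))) + 2 - 1 =
     (2 * pi)^-1 * (\int[lebesgue_measure]_(s in `[0, N%:R * l]) g s + N%:R * l).
    have E (c x : R) : c != 0 -> c^-1 * x + 2 - 1 = c^-1 * (x + c) by move=> c0; field.
    by rewrite Nl; apply: E; rewrite gt_eqF.
  rewrite ler_pM2l ?invr_gt0//; apply: riemann_sum_le => // j s jN /(osc _ _ jN).
  by rewrite ler_norml => /andP[]; lra.
pose h w := f w * cexp (- 1 * P w).
have hH : holo h.
  apply: holoM => //; apply: (holo_comp cexp (fun w => -1 * P w)); first exact: holo_cexp.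
  by apply: holoM => //; exact: holo_cst.
have h1 w : cmod w = r -> cmod (h w) <= 1.
  move=> wr; have [t [t2 wE]] := polar_surj w; rewrite wr in wE.
  rewrite /h cmodM cmod_cexp mulN1r cReN expRN ler_pdivrMr ?expR_gt0// mul1r.
  rewrite (le_trans (le_expR_logp _ (cmod_ge0 _)))// ler_expR wE; exact: major.
have := maximum_principle h r hH r0 h1 z; rewrite (le_trans zr) => [/(_ isT)|]; last first.
  by rewrite ler_pdivrMr// ler_peMr ?ler1n// ltW.
rewrite /h cmodM cmod_cexp mulN1r cReN expRN ler_pdivrMr ?expR_gt0// mul1r => /le_trans; apply.
by rewrite ler_expR.
Qed.

End Proximity.

(** * Nevanlinna characteristics and the growth of small functions *)

Section Growth.
Context {R : realType}.
Implicit Types (f : R[i] -> R[i]) (z w : R[i]) (r : R) (p : {poly R[i]}).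

Lemma pole_order_holo f z : holo f -> pole_order f z = 0%N.
Proof.
move=> fH; have pb : pole_bounded f z 0.
  exists (cmod (f z) + 1).
  have [r r0 Hr] := holo_cont _ fH z _ ltr01.
  apply/nbhs_ballP; exists (r%:C) => /=; first by rewrite ltcR.
  move=> w; rewrite -ball_normE/= norm_cmod ltcR => /ltW wr _.
  rewrite expr0 mul1r -lerBlDl (le_trans (ge_cmodB _ _))//.
  by apply: Hr; rewrite cmodBC.
rewrite /pole_order; apply: xget_unique; first by split.
by move=> n [_ /(_ _ pb)]; rewrite leqn0 => /eqP.
Qed.

Lemma characteristic_holo f r : holo f -> characteristic f r = proximity f r.
Proof.
move=> fH; have pc t : pole_count f t = 0%N.
  by apply: fsbig1 => z _; exact: pole_order_holo.
rewrite /characteristic /counting_fun pc mul0r addr0.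
under eq_Rintegral do rewrite pc subrr mul0r.
by rewrite Rintegral_cst// mul0r addr0.
Qed.

Lemma proximity_ge0 f r : 0 <= proximity f r.
Proof.
rewrite mulr_ge0 ?invr_ge0 ?mulr_ge0 ?pi_ge0//.
by apply: Rintegral_ge0 => t _; exact: logp_ge0.
Qed.

Lemma proximity_le f r (M : R) : holo f ->
  (forall t, logp (cmod (f (polar r t))) <= M) -> proximity f r <= M.
Proof.
move=> fH HM; have gc := continuous_logp_polar f r fH.
have [G dG] := ex_primitive _ gc.
have p2 : 0 < 2 * pi :> R by rewrite mulr_gt0 ?pi_gt0.
rewrite /proximity (Rintegral_primitive _ _ _ _ p2 gc dG).
have [|c _ ->] := MVT p2 (fun x _ => dG x).
  by apply: continuous_subspaceT; exact: is_derive_continuous dG.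
by rewrite subr0 mulrCA mulVf ?mulr1// gt_eqF.
Qed.

(** Beyond radius [m] one surplus power of |z| absorbs the coefficient; inside, the constant
    does. *)
Lemma monomial_le (c : R[i]) (i k : nat) (e : R) : (i < k)%N -> 0 < e ->
  exists2 C : R, 0 <= C & forall z, cmod (c * z ^+ i) <= e * cmod z ^+ k + C.
Proof.
move=> ik e0; pose m := Num.max 1 (cmod c / e).
have m1 : 1 <= m by rewrite le_max lexx.
have m0 : 0 <= m by exact: le_trans m1.
exists (cmod c * m ^+ i) => [|z]; first by rewrite mulr_ge0 ?cmod_ge0// exprn_ge0.
have z0 := cmod_ge0 z; rewrite cmodM cmodX.
have [zm|/ltW mz] := leP (cmod z) m.
  rewrite ler_wpDl ?mulr_ge0 ?exprn_ge0 ?(ltW e0)// ler_wpM2l ?cmod_ge0//.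
  by rewrite lerXn2r ?nnegrE.
rewrite ler_wpDr ?mulr_ge0 ?cmod_ge0 ?exprn_ge0//.
have cz : cmod c <= e * cmod z.
  by rewrite mulrC -ler_pdivrMr// (le_trans _ mz)// le_max lexx orbT.
apply: (@le_trans _ _ (e * cmod z * cmod z ^+ i)); first by rewrite ler_wpM2r ?exprn_ge0.
rewrite -mulrA -exprS ler_pM2l// ler_weXn2l//; exact: le_trans mz.
Qed.

Lemma poly_sub_lead_le p k (e : R) : size p = k.+1 -> 0 < e ->
  exists2 C : R, 0 <= C &
    forall z, cmod (p.[z] - lead_coef p * z ^+ k) <= e * cmod z ^+ k + C.
Proof.
move=> pk e0.
have pE z : p.[z] - lead_coef p * z ^+ k = \sum_(i < k) p`_i * z ^+ i.
  by rewrite horner_coef pk big_ord_recr/= lead_coefE pk addrK.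
suff H n : (n <= k)%N -> forall e : R, 0 < e -> exists2 C : R, 0 <= C &
    forall z, cmod (\sum_(i < n) p`_i * z ^+ i) <= e * cmod z ^+ k + C.
  have [C C0 HC] := H k (leqnn _) _ e0; exists C => // z; rewrite pE; exact: HC.
elim: n => [|n IH] nk {}e {}e0.
  by exists 0 => // z; rewrite big_ord0 cmod0 addr0 mulr_ge0 ?exprn_ge0 ?cmod_ge0// ltW.
have e20 : 0 < e / 2 by rewrite divr_gt0.
have [C C0 HC] := IH (ltnW nk) _ e20.
have [D D0 HD] := monomial_le p`_n n k _ nk e20.
exists (C + D) => [|z]; first by rewrite addr_ge0.
rewrite big_ord_recr/= (le_trans (le_cmodD _ _))// (le_trans (lerD (HC z) (HD z)))//.
by rewrite addrACA -mulrDl -splitr.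
Qed.

Lemma holo_cexp_poly p : holo (fun z => cexp p.[z]).
Proof.
by apply: (holo_comp cexp (fun z => p.[z])); [exact: holo_cexp | exact: holo_poly].
Qed.

Lemma characteristic_cexp_poly_le p k : size p = k.+1 ->
  exists2 A : R, 0 < A & forall r, 0 <= r ->
    `|characteristic (fun z => cexp p.[z]) r| <= A * r ^+ k + A.
Proof.
move=> pk; have [C C0 HC] := poly_sub_lead_le _ _ _ pk ltr01.
pose A := cmod (lead_coef p) + 1 + C.
have A0 : 0 < A by rewrite ltr_wpDr// ltr_wpDl ?cmod_ge0.
exists A => // r r0; have eH := holo_cexp_poly p.
rewrite characteristic_holo// ger0_norm ?proximity_ge0//.
apply: proximity_le => // t; rewrite cmod_cexp /logp expRK ge_max.
have rk : 0 <= r ^+ k by rewrite exprn_ge0.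
rewrite addr_ge0 ?mulr_ge0 ?(ltW A0)//= (le_trans (ler_Re_cmod _))//.
rewrite -(subrK (lead_coef p * polar r t ^+ k) p.[_]) (le_trans (le_cmodD _ _))//.
rewrite cmodM cmodX; have := HC (polar r t); rewrite cmod_polar// mul1r => H.
apply: (le_trans (lerD H (lexx _))).
have l0 := cmod_ge0 (lead_coef p).
have := mulr_ge0 C0 rk; rewrite /A !mulrDl mul1r; lra.
Qed.

(** The interval [2 r, 3 r] has measure [r], too large to fit in [E]. *)
Lemma ex_outside_finite_measure (E : set R) r : measurable E ->
  (lebesgue_measure E < +oo)%E -> fine (lebesgue_measure E) < r ->
  exists2 s, 2 * r <= s <= 3 * r & ~ E s.
Proof.
move=> mE fE rE; apply: contrapT => H.
have sub : `[2 * r, 3 * r]%classic `<=` E.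
  move=> s; rewrite /= in_itv/= => srE; apply: contrapT => nE; apply: H.
  by exists s.
have r0 : 0 < r by exact: le_lt_trans (fine_ge0 (measure_ge0 _ _)) rE.
have Efin : lebesgue_measure E \is a fin_num by rewrite ge0_fin_numE.
have mI : lebesgue_measure `[2 * r, 3 * r]%classic = r%:E.
  rewrite lebesgue_measure_itv/= lte_fin ltr_pM2r// ltr_nat/= -EFinB -mulrBl.
  by rewrite (_ : 3 - 2 = 1 :> R) ?mul1r//; ring.
have : (r%:E <= lebesgue_measure E)%E.
  by rewrite -mI; apply: le_measure => //; rewrite inE.
by rewrite -(fineK Efin) lee_fin leNgt rE.
Qed.

Lemma small_function_growth (beta : R[i] -> R[i]) p k : size p = k.+1 -> holo beta ->
  small_function beta (fun z => cexp p.[z]) ->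
  forall e : R, 0 < e -> exists2 C : R, 0 <= C &
    forall z, cmod (beta z) <= expR (e * cmod z ^+ k + C).
Proof.
move=> pk bH [E [mE fE HE]] e e0.
have [A A0 HA] := characteristic_cexp_poly_le _ _ pk.
(* Compensates the factor 324 of [cmod_le_proximity], the factor 3^k from s <= 3 |z|, and the
   constant [A] in the bound for the characteristic of exp p. *)
pose e1 := e / (324 * 3 ^+ k * A).
have c0 : 0 < 324 * 3 ^+ k * A by rewrite !mulr_gt0 ?exprn_gt0.
have e10 : 0 < e1 by rewrite divr_gt0.
have [r0 Hr0] := HE _ e10.
(* From this radius on, a good [s] exists beyond [r0]. Smaller [z] are covered by the constant [C2],
   the bound at the single radius [2 * r1]. *)
pose r1 := Num.max (Num.max r0 1) (fine (lebesgue_measure E) + 1).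
have r11 : 1 <= r1 by rewrite !le_max lexx orbT.
have r10 : 0 < r1 by exact: lt_le_trans r11.
pose C1 := 324 * (e1 * A + 2); pose C2 := 324 * (proximity beta (2 * r1) + 2).
have C10 : 0 <= C1 by rewrite mulr_ge0// addr_ge0// mulr_ge0// ltW.
have C20 : 0 <= C2 by rewrite mulr_ge0// addr_ge0// proximity_ge0.
exists (C1 + C2) => [|z]; first by rewrite addr_ge0.
have z0 := cmod_ge0 z; have zk : 0 <= cmod z ^+ k by rewrite exprn_ge0.
have [zr|/ltW rz] := leP (cmod z) r1.
  have := cmod_le_proximity beta (2 * r1) z bH; rewrite mulr_gt0// => /(_ isT).
  rewrite [2 * r1 / 2]mulrAC divff// mul1r => /(_ zr)/le_trans; apply.
  rewrite ler_expR -/C2; have := mulr_ge0 (ltW e0) zk; lra.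
have [|s /andP[s2 s3] nEs] := ex_outside_finite_measure _ (cmod z) mE fE.
  by rewrite (lt_le_trans _ rz)// lt_max ltrDl ltr01 orbT.
have zgt0 : 0 < cmod z by exact: lt_le_trans rz.
have s0 : 0 < s by rewrite (lt_le_trans _ s2)// mulr_gt0.
have rs : r0 <= s.
  have : r0 <= r1 by rewrite !le_max lexx.
  lra.
have := cmod_le_proximity beta s z bH s0.
rewrite ler_pdivlMr// mulrC => /(_ s2)/le_trans; apply; rewrite ler_expR.
have := Hr0 s rs nEs; rewrite (characteristic_holo beta)// ger0_norm ?proximity_ge0// => H.
have sk : s ^+ k <= 3 ^+ k * cmod z ^+ k by rewrite -exprMn lerXn2r// nnegrE ?mulr_ge0// ltW.
have H1 : proximity beta s <= e1 * (A * (3 ^+ k * cmod z ^+ k) + A).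
  apply: (le_trans H); rewrite ler_pM2l// (le_trans (HA _ (ltW s0)))// lerD2r ler_pM2l//.
have e1E : 324 * (e1 * (A * (3 ^+ k * cmod z ^+ k) + A)) = e * cmod z ^+ k + 324 * (e1 * A).
  rewrite /e1; field; by rewrite (gt_eqF A0) expf_neq0.
rewrite /C1; lra.
Qed.

End Growth.

(** * Estimates in the sectors *)

Section Asymptotics.
Context {R : realType}.
Implicit Types (z w : R[i]) (r s t c e : R).

Lemma sqr_half_le_expR (x : R) : 0 <= x -> (x / 2) ^+ 2 <= expR x.
Proof.
move=> x0; have -> : expR x = expR (x / 2) ^+ 2 by rewrite expr2 -expRD -splitr.
rewrite lerXn2r ?nnegrE ?expR_ge0 ?divr_ge0//.
by rewrite (le_trans _ (expR_ge1Dx _))// lerDr.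
Qed.

Lemma le_self_exprn (k : nat) r : (0 < k)%N -> 1 <= r -> r <= r ^+ k.
Proof. by move=> k0 r1; rewrite -{1}(expr1 r) ler_weXn2l. Qed.

Lemma expR_absorbs (k : nat) (a C : R) e : (0 < k)%N -> 0 < e ->
  exists2 r0, 1 <= r0 & forall r, r0 <= r ->
    (r + a) * expR (e / 2 * r ^+ k + C) <= expR (e * r ^+ k).
Proof.
move=> k0 e0; pose K := expR C; have K0 : 0 < K by exact: expR_gt0.
(* The first two bounds give r + a <= 2 r and r <= r^k. The last says 2 r K <= (e r / 4)^2, which is
   at most exp (e r / 2). *)
exists (Num.max (Num.max 1 a) (32 * K / e ^+ 2)) => [|r].
  by rewrite !le_max lexx.
rewrite !ge_max => /andP[/andP[r1 ra] rK].
have r0 : 0 < r by exact: lt_le_trans r1.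
have -> : e * r ^+ k = e / 2 * r ^+ k + e / 2 * r ^+ k by field.
rewrite !expRD mulrCA ler_pM2l ?expR_gt0//.
apply: (@le_trans _ _ (expR (e / 2 * r))); last first.
  by rewrite ler_expR ler_pM2l ?divr_gt0// le_self_exprn.
have er0 : 0 <= e / 2 * r by rewrite mulr_ge0// ltW// divr_gt0.
apply: (le_trans _ (sqr_half_le_expR _ er0)).
apply: (@le_trans _ _ (2 * r * K)); first by rewrite ler_pM2r//; lra.
have -> : (e / 2 * r / 2) ^+ 2 = r * (r * e ^+ 2 / 16) by field.
have -> : 2 * r * K = r * (2 * K) by ring.
rewrite ler_pM2l// ler_pdivlMr//.
rewrite ler_pdivrMr ?exprn_gt0// in rK; lra.
Qed.

Lemma expR_decay (k : nat) (c C D e : R) : (0 < k)%N -> 0 < c -> 0 <= D -> 0 < e ->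
  exists2 s0, 1 <= s0 & forall s, s0 <= s -> s * D * expR (C - c * s ^+ k) <= e.
Proof.
move=> k0 c0 D0 e0; pose K := D * expR C.
(* The second bound says s K <= e (c s / 2)^2, which is at most e exp (c s). *)
exists (Num.max 1 (4 * K / (c ^+ 2 * e))) => [|s]; first by rewrite le_max lexx.
rewrite ge_max => /andP[s1 sK]; have s0 : 0 < s by exact: lt_le_trans s1.
rewrite expRD expRN mulrA ler_pdivrMr ?expR_gt0//.
apply: (@le_trans _ _ (e * expR (c * s))); last first.
  by rewrite ler_pM2l// ler_expR ler_pM2l// le_self_exprn.
have cs0 : 0 <= c * s by rewrite ltW// mulr_gt0.
apply: (@le_trans _ _ (e * (c * s / 2) ^+ 2)); last first.
  by rewrite ler_pM2l// sqr_half_le_expR.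
have -> : e * (c * s / 2) ^+ 2 = s * (s * (c ^+ 2 * e) / 4) by field.
rewrite -!mulrA ler_pM2l// !mulrA ler_pdivlMr//.
rewrite ler_pdivrMr ?mulr_gt0 ?exprn_gt0// /K in sK; lra.
Qed.

Lemma cauchy_pinfty_cvg (g : R -> R) :
  (forall e, 0 < e -> exists S, forall s t, S <= s -> S <= t -> `|g s - g t| <= e) ->
  exists l, forall e, 0 < e -> exists S, forall s, S <= s -> `|g s - l| <= e.
Proof.
move=> H.
(* Consecutive thresholds need not be ordered, so [g] is compared at both with its value at their
   maximum; halving the tolerance leaves room for the two steps. *)
have lim2 n : exists S, forall s t, S <= s -> S <= t -> `|g s - g t| <= (2 / 2 ^+ n.+1) / 2.
  by apply: H; rewrite !divr_gt0// exprn_gt0.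
pose T n := projT1 (cid (lim2 n)); have HT n : forall s t, _ := projT2 (cid (lim2 n)).
have [l Hl] : exists l, forall n, `|g (T n) - l| <= 2 / 2 ^+ n.
  apply: geometric_cauchy_cvg => n.
  have h0 : 0 <= 2 / 2 ^+ n.+1 :> R by rewrite divr_ge0// exprn_ge0.
  pose m := Num.max (T n) (T n.+1).
  have H1 := HT n m (T n); have H2 := HT n.+1 (T n.+1) m.
  move: H1 H2; rewrite /m !le_max !lexx !orbT => /(_ isT isT) H1 /(_ isT isT) H2.
  rewrite -(subrK (g m) (g (T n.+1))) -addrA (le_trans (ler_normD _ _))//.
  have H3 : 2 / 2 ^+ n.+2 <= 2 / 2 ^+ n.+1 :> R.
    by rewrite ler_pM2l// lef_pV2 ?posrE ?exprn_gt0// ler_weXn2l// ler1n.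
  rewrite -/m in H1 H2; lra.
exists l => e e0; have [n Hn] := ex_div_pow2_le 4 e e0.
exists (T n) => s sT; have H1 := HT n s (T n) sT (lexx _); have H2 := Hl n.
rewrite -(subrK (g (T n)) (g s)) -addrA (le_trans (ler_normD _ _))//.
have h0 : 0 <= 2 / 2 ^+ n :> R by rewrite divr_ge0// exprn_ge0.
have E : 4 / 2 ^+ n = 2 / 2 ^+ n + 2 / 2 ^+ n :> R by rewrite -mulrDl -natrD.
have E2 : 2 / 2 ^+ n.+1 <= 2 / 2 ^+ n :> R.
  by rewrite ler_pM2l// lef_pV2 ?posrE ?exprn_gt0// ler_weXn2l// ler1n.
lra.
Qed.

Lemma Re_lead_polar (p : {poly R[i]}) (k : nat) r t : size p = k.+1 ->
  complex.Re (lead_coef p * polar r t ^+ k) = r ^+ k * delta p t.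
Proof.
by move=> pk; rewrite polarX cReM/= /delta pk/=; ring.
Qed.

Lemma continuous_delta (p : {poly R[i]}) : continuous (delta p).
Proof.
have C n (g : R -> R) : continuous g -> continuous (fun t : R => g (n%:R * t)).
  move=> gc t; apply: (continuous_comp (f := fun t : R => n%:R * t) (g := g)); last exact: gc.
  exact: mulrl_continuous.
by move=> t; apply: cvgB; apply: cvgM; try exact: cvg_cst;
  apply: C; [exact: continuous_cos | exact: continuous_sin].
Qed.

(** * Bounds for [F] along segments, rays and arcs *)

Section Integrand.
Variables (k : nat) (p : {poly R[i]}) (beta : R[i] -> R[i]).
Hypothesis k0 : (0 < k)%N.
Hypothesis pk : size p = k.+1.
Hypothesis betaH : holo beta.
Hypothesis beta_growth : forall e, 0 < e -> exists2 C : R, 0 <= C &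
  forall z, cmod (beta z) <= expR (e * cmod z ^+ k + C).

Let f z := beta z * cexp (- p.[z]).
Let F := cint0 f.

Lemma holo_integrand : holo f.
Proof.
apply: holoM => //; rewrite (_ : (fun z => _) = fun z => cexp (-1 * p.[z])).
  apply: (holo_comp cexp (fun z => -1 * p.[z])); first exact: holo_cexp.
  by apply: holoM; [exact: holo_cst | exact: holo_poly].
by apply/funext => z; rewrite mulN1r.
Qed.

Lemma cderiv_cint0_integrand z : cderiv F z (f z).
Proof. exact: cderiv_cint0 holo_integrand. Qed.

Lemma integrand_bounds e : 0 < e -> exists2 C : R, 0 <= C &
  (forall z, cmod (f z) <= expR (e * cmod z ^+ k + C - complex.Re p.[z])) /\
  (forall z, `|complex.Re p.[z] - complex.Re (lead_coef p * z ^+ k)| <= e * cmod z ^+ k + C).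
Proof.
move=> e0; have [C C0 HC] := beta_growth e e0.
have [D D0 HD] := poly_sub_lead_le p k e pk e0.
exists (C + D); first by rewrite addr_ge0.
split=> z.
  rewrite cmodM cmod_cexp cReN expRD ler_pM2r ?expR_gt0// (le_trans (HC z))//.
  by rewrite ler_expR addrA lerDl.
rewrite -cReB (le_trans (Re_le_cmod _))// (le_trans (HD z))//.
by rewrite lerD2l lerDr.
Qed.

(** If L = Re (lead z^k) <= 0 then L <= t^k L for 0 <= t <= 1, so the leading terms of p z and p (t
    z) compare favourably and only errors remain. The first bound serves the term [a * cexp
    p.[z]]. *)
Lemma decreasing_sector_bound e : 0 < e -> exists C : R, forall z,
  complex.Re (lead_coef p * z ^+ k) <= 0 ->
  cmod (cexp p.[z]) <= expR (3 * e * cmod z ^+ k + C) /\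
  cmod (cexp p.[z] * F z) <= cmod z * expR (3 * e * cmod z ^+ k + C).
Proof.
move=> e0; have [C C0 [Hf Hp]] := integrand_bounds _ e0.
exists (3 * C) => z Lz; have z0 := cmod_ge0 z.
have zk : 0 <= e * cmod z ^+ k by rewrite mulr_ge0 ?exprn_ge0// ltW.
have := Hp z; rewrite ler_norml => /andP[Hp1 Hp2]; split.
  by rewrite cmod_cexp ler_expR; lra.
have F0 : F 0 = 0 by rewrite /F /cint0 mul0r.
have := @mvi_line _ F f 0 z (expR (3 * e * cmod z ^+ k + 3 * C - complex.Re p.[z])) cderiv_cint0_integrand.
rewrite F0 !subr0 => H; rewrite cmodM cmod_cexp.
apply: (@le_trans _ _ (expR (complex.Re p.[z]) *
    (expR (3 * e * cmod z ^+ k + 3 * C - complex.Re p.[z]) * cmod z))).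
  rewrite ler_pM2l ?expR_gt0//; apply: H => t /andP[t0 t1].
  rewrite add0r (le_trans (Hf _))// ler_expR.
  have := Hp (t%:C * z); rewrite cmodM cmod_real [`|t|]ger0_norm// [(t * _) ^+ k]exprMn => Hpt.
  have tk0 : 0 <= t ^+ k by rewrite exprn_ge0.
  have tk1 : t ^+ k <= 1 by rewrite exprn_ile1.
  have LE : complex.Re (lead_coef p * (t%:C * z) ^+ k) = t ^+ k * complex.Re (lead_coef p * z ^+ k).
    by rewrite exprMn -rmorphXn/= -cReZ; congr complex.Re; ring.
  rewrite LE in Hpt; move: Hpt; rewrite ler_norml => /andP[Hpt1 Hpt2].
  set L := complex.Re (lead_coef p * _) in Lz Hp1 Hp2 Hpt1 Hpt2.
  have LtL : L <= t ^+ k * L by rewrite ler_niMl.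
  have tz : e * (t ^+ k * cmod z ^+ k) <= e * cmod z ^+ k.
    by rewrite ler_pM2l// ler_piMl// exprn_ge0.
  lra.
by rewrite mulrA -expRD mulrC ler_wpM2l// ler_expR; lra.
Qed.

(** At radius t the scaled integrand has exponent at most K - (delta - 2 e) (t^k - r^k). As delta -
    2 e >= c / 2 = d and t^k - r^k >= t - r for r >= 1, it is below exp (K - d (t - r)), whose
    integral is at most exp K / d. The bound is independent of [s], so [s] may tend to infinity. *)
Lemma ray_bound c e : 0 < c -> 0 < e -> 8 * e <= c -> exists C : R,
  forall t r s, c <= delta p t -> 1 <= r -> r <= s ->
  cmod (cexp p.[polar r t]) * cmod (F (polar s t) - F (polar r t)) <=
    2 / c * expR (3 * e * r ^+ k + C).
Proof.
move=> c0 e0 ec; have [C C0 [Hf Hp]] := integrand_bounds _ e0.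
exists (3 * C) => th r s cth r1 rs.
have r0 : 0 < r by exact: lt_le_trans r1.
pose K := 3 * e * r ^+ k + 3 * C; pose d := c / 2.
have d0 : 0 < d by rewrite divr_gt0.
pose u : R[i] := polar 1 th.
have uE t : polar t th = 0 + t%:C * u by rewrite add0r -polarZ.
pose X t := cexp p.[polar r th] * F (0 + t%:C * u).
pose X' t := cexp p.[polar r th] * (f (0 + t%:C * u) * u).
pose B t := - d^-1 * expR (K - d * (t - r)).
pose B' t := expR (K - d * (t - r)).
have dX t : rcderiv X t (X' t).
  rewrite /X' mulrA; apply: (@cderiv_line _ (fun z => cexp p.[polar r th] * F z)).
  have := cderivM _ _ _ _ _ (cderiv_cst (cexp p.[polar r th]) (0 + t%:C * u)) (cderiv_cint0_integrand (0 + t%:C * u)).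
  by apply: cderiv_eq; rewrite mul0r add0r.
have dB t : is_derive t 1 B (B' t).
  have lin : is_derive t 1 (fun t => K - d * (t - r)) (- d).
    by apply: is_derive_eq; rewrite /GRing.scale/=; ring.
  have ex := @is_derive1_comp _ expR (fun t : R => K - d * (t - r)) t _ _ (is_derive_expR _) lin.
  have := is_deriveZ (- d^-1) ex.
  rewrite /B' (_ : _ *: _ = expR (K - d * (t - r))); first by [].
  by rewrite /GRing.scale/=; field; rewrite gt_eqF.
have XB t : r <= t <= s -> cmod (X' t) <= B' t.
  move=> /andP[rt ts]; rewrite /X' cmodM [cmod (_ * u)]cmodM (cmod_polar 1 th ler01) mulr1 cmod_cexp -uE.
  have t0 : 0 < t by exact: lt_le_trans rt.
  have tk : r ^+ k <= t ^+ k by rewrite lerXn2r// nnegrE ltW.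
  have trk : t - r <= t ^+ k - r ^+ k.
    case: (k) k0 => // n _; rewrite !exprS.
    have rn : 1 <= r ^+ n by rewrite exprn_ege1.
    have tn : r ^+ n <= t ^+ n by rewrite lerXn2r// nnegrE ltW.
    have : t * r ^+ n <= t * t ^+ n by rewrite ler_pM2l.
    have : (t - r) * 1 <= (t - r) * r ^+ n by rewrite ler_wpM2l// subr_ge0.
    rewrite mulr1 mulrBl; lra.
  have := Hp (polar r th); rewrite Re_lead_polar// cmod_polar ?(ltW r0)// ler_norml => /andP[_ H1].
  have := Hp (polar t th); rewrite Re_lead_polar// cmod_polar ?(ltW t0)// ler_norml => /andP[H2 _].
  have := Hf (polar t th); rewrite cmod_polar ?(ltW t0)// => H3.
  apply: (@le_trans _ _ (expR (complex.Re p.[polar r th]) * expR (e * t ^+ k + C - complex.Re p.[polar t th]))).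
    by rewrite ler_pM2l ?expR_gt0.
  rewrite -expRD ler_expR /K.
  set D := delta p th in cth H1 H2; set rk := r ^+ k in tk trk H1 *; set tk' := t ^+ k in tk trk H2 *.
  have m1 : d * (t - r) <= d * (tk' - rk) by rewrite ler_pM2l.
  have m2 : d * (tk' - rk) <= (D - 2 * e) * (tk' - rk).
    by rewrite ler_wpM2r ?subr_ge0// /d; lra.
  have {}m2 : d * (t - r) <= (D - 2 * e) * (tk' - rk) by exact: le_trans m2.
  lra.
have := @mvi_cmp _ X X' B B' r s rs (fun t _ => dX t) (fun t _ => dB t) XB.
rewrite /X -mulrBr cmodM -!uE => /le_trans; apply.
rewrite /B subrr mulr0 subr0 -/K.
have -> : 2 / c = d^-1 by rewrite /d; field; rewrite gt_eqF.
have := expR_gt0 (K - d * (s - r)); rewrite -(pmulr_rgt0 _ (_ : 0 < d^-1)) ?invr_gt0//; lra.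
Qed.

(** The arc is the image under exp of a vertical segment at abscissa ln s, so the chain rule reduces
    it to a straight path. *)
Lemma arc_bound c e : 0 < c -> 0 < e -> 8 * e <= c -> exists C : R,
  forall t0 t1 s, 0 < s ->
  (forall t, Num.min t0 t1 <= t <= Num.max t0 t1 -> c <= delta p t) ->
  cmod (F (polar s t1) - F (polar s t0)) <=
    s * `|t1 - t0| * expR (C - c / 2 * s ^+ k).
Proof.
move=> c0 e0 ec; have [C C0 [Hf Hp]] := integrand_bounds _ e0.
exists (2 * C) => t0 t1 s s0 Hd.
have pE t : polar s t = cexp ((ln s)%:C + t%:C * 'i%C) :> R[i].
  rewrite -(cexp_polar _ t s0); congr cexp; rewrite [LHS]complexE/=; congr (_ + _).
  exact: mulrC.
pose X t := F (cexp ((ln s)%:C + t%:C * 'i%C)).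
pose X' t := f (polar s t) * polar s t * 'i%C.
have -> : s * `|t1 - t0| * expR (2 * C - c / 2 * s ^+ k) =
    expR (2 * C - c / 2 * s ^+ k) * s * `|t1 - t0| by ring.
rewrite !pE; apply: (mvi X X') => t tI.
  apply: (@cderiv_line _ (fun w => F (cexp w))).
  rewrite /X' pE; apply: cderiv_comp; first exact: cderiv_cexp.
  exact: cderiv_cint0_integrand.
rewrite /X' cmodM cmod_i mulr1 cmodM cmod_polar ?(ltW s0)// ler_pM2r//.
rewrite (le_trans (Hf _))// ler_expR cmod_polar ?(ltW s0)//.
have := Hp (polar s t); rewrite Re_lead_polar// cmod_polar ?(ltW s0)// ler_norml => /andP[H1 _].
have sk : 0 < s ^+ k by rewrite exprn_gt0.
have m : s ^+ k * (c / 2) <= s ^+ k * (delta p t - 2 * e).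
  by rewrite ler_pM2l//; have := Hd t tI; lra.
lra.
Qed.

(** Dividing [ray_bound] from radius S by |exp p| leaves the exponent (4 e1 - c) S^k up to a
    constant; with e1 = c / 8 this is - (c / 2) S^k, so [F] is Cauchy along the ray. *)
Lemma ray_limit t : 0 < delta p t -> exists a : R[i], forall e, 0 < e ->
  exists S, forall s, S <= s -> cmod (F (polar s t) - a) <= e.
Proof.
move=> c0; pose c := delta p t; pose e1 := c / 8.
have e10 : 0 < e1 by rewrite divr_gt0.
have ec : 8 * e1 <= c by rewrite /e1; lra.
have [C HC] := ray_bound c e1 c0 e10 ec.
have [D D0 [_ Hp]] := integrand_bounds _ e10.
have cau e : 0 < e -> exists S, forall s s', S <= s -> S <= s' ->
    cmod (F (polar s t) - F (polar s' t)) <= e.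
  move=> e0; have e20 : 0 < e / 2 by rewrite divr_gt0.
  have c20 : 0 <= 2 / c by rewrite divr_ge0 ?ltW.
  have c40 : 0 < c / 2 by rewrite divr_gt0.
  have [S S1 HS] := expR_decay k (c / 2) (C + D) (2 / c) (e / 2) k0 c40 c20 e20.
  have tail s : S <= s -> cmod (F (polar s t) - F (polar S t)) <= e / 2.
    move=> Ss; have := HC t S s (lexx _) S1 Ss; rewrite cmod_cexp mulrC -ler_pdivlMr ?expR_gt0//.
    move=> /le_trans; apply; rewrite -expRN -[leLHS]mulrA -expRD.
    apply: (le_trans _ (HS S (lexx _))).
    have S0 : 0 < S by exact: lt_le_trans S1.
    apply: (@le_trans _ _ (2 / c * expR (C + D - c / 2 * S ^+ k))); last first.
      by rewrite -[leRHS]mulrA ler_peMl// mulr_ge0// expR_ge0.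
    rewrite ler_wpM2l// ler_expR.
    have := Hp (polar S t); rewrite Re_lead_polar// cmod_polar ?(ltW S0)// ler_norml => /andP[H _].
    rewrite -/c in H; have Sk : 0 < S ^+ k by rewrite exprn_gt0.
    by rewrite /e1 in H *; lra.
  exists S => s s' Ss Ss'; rewrite -(subrK (F (polar S t)) (F (polar s t))) -addrA.
  apply: (le_trans (le_cmodD _ _)); rewrite [leRHS](splitr e); apply: lerD; first exact: tail.
  by rewrite cmodBC; exact: tail.
have [|x Hx] := cauchy_pinfty_cvg (fun s => complex.Re (F (polar s t))).
  move=> e /cau[S HS]; exists S => s s' Ss Ss'.
  by rewrite -cReB (le_trans (Re_le_cmod _))// HS.
have [|y Hy] := cauchy_pinfty_cvg (fun s => complex.Im (F (polar s t))).
  move=> e /cau[S HS]; exists S => s s' Ss Ss'.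
  by rewrite -cImB (le_trans (Im_le_cmod _))// HS.
exists (x +i* y) => e e0; have e20 : 0 < e / 2 by rewrite divr_gt0.
have [S HS] := Hx _ e20; have [T HT] := Hy _ e20.
exists (Num.max S T) => s; rewrite ge_max => /andP[Ss Ts].
rewrite (le_trans (le_cmod_ReIm _))// cReB cImB [leRHS](splitr e).
by apply: lerD; [exact: HS | exact: HT].
Qed.

(** From the point one goes out along its ray to radius [s], across the arc to angle [t0], and
    compares with the limit [a] there. The constant [a] depends on [t0] only, not on [u] and [v]. *)
Lemma increasing_sector_bound (t0 u v c e : R) (a : R[i]) :
  (forall e, 0 < e -> exists S, forall s, S <= s -> cmod (F (polar s t0) - a) <= e) ->
  u <= t0 <= v -> 0 < c -> 0 < e -> 8 * e <= c ->
  (forall t, u <= t <= v -> c <= delta p t) ->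
  exists C : R, forall r t, 1 <= r -> u <= t <= v ->
    cmod (cexp p.[polar r t] * (F (polar r t) - a)) <=
      2 / c * expR (3 * e * r ^+ k + C) + 1.
Proof.
move=> Ha /andP[ut0 t0v] c0 e0 ec Hd.
have [C HC] := ray_bound c e c0 e0 ec.
have [D HD] := arc_bound c e c0 e0 ec.
exists C => r t r1 /andP[ut tv]; rewrite cmodM.
set E := cmod (cexp _); have E0 : 0 < E by rewrite /E cmod_cexp expR_gt0.
(* The tolerance, and with it [s], may depend on the point: the arc and the limit cost
   [E * (eps + eps) = 1], the additive 1 of the statement. *)
pose eps := (2 * E)^-1; have eps0 : 0 < eps by rewrite invr_gt0 mulr_gt0.
have c20 : 0 < c / 2 by rewrite divr_gt0.
have [S S1 HS] := expR_decay k (c / 2) D `|t0 - t| eps k0 c20 (normr_ge0 _) eps0.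
have [T HT] := Ha _ eps0.
pose s := Num.max (Num.max S T) r.
have Ss : S <= s by rewrite !le_max lexx.
have Ts : T <= s by rewrite !le_max lexx orbT.
have rs : r <= s by rewrite le_max lexx orbT.
have s0 : 0 < s := lt_le_trans (lt_le_trans ltr01 r1) rs.
have H1 : E * cmod (F (polar s t) - F (polar r t)) <= 2 / c * expR (3 * e * r ^+ k + C).
  by apply: HC => //; apply: Hd; rewrite ut.
have H2 : cmod (F (polar s t0) - F (polar s t)) <= eps.
  apply: le_trans (HS s Ss); apply: HD => // x /andP[x1 x2]; apply: Hd.
  by rewrite (le_trans _ x1) ?le_min ?ut//= (le_trans x2)// ge_max tv.
have H3 : cmod (F (polar s t0) - a) <= eps by exact: HT.
have -> : F (polar r t) - a = - (F (polar s t) - F (polar r t)) +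
    (- (F (polar s t0) - F (polar s t)) + (F (polar s t0) - a)) by ring.
apply: (@le_trans _ _ (E * (cmod (F (polar s t) - F (polar r t)) + (eps + eps)))).
  rewrite ler_pM2l// (le_trans (le_cmodD _ _))// cmodN lerD2l.
  by rewrite (le_trans (le_cmodD _ _))// cmodN lerD.
rewrite mulrDr lerD// -mulr2n mulrnAr -mulr_natl mulrA /eps mulfV// gt_eqF//.
by rewrite mulr_gt0.
Qed.

End Integrand.

Lemma Re_lead_closure_le0 (p : {poly R[i]}) (k : nat) (D : set (Cplx R)) z :
  (forall w, D w -> complex.Re (lead_coef p * w ^+ k) <= 0) ->
  closure D z -> complex.Re (lead_coef p * z ^+ k) <= 0.
Proof.
move=> HD Dz; rewrite leNgt; apply/negP => L0.
have gH : holo (fun w => lead_coef p * w ^+ k).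
  rewrite (_ : (fun w => _) = fun w => (lead_coef p *: 'X^k).[w]); first exact: holo_poly.
  by apply/funext => w; rewrite hornerZ hornerXn.
have L20 : 0 < complex.Re (lead_coef p * z ^+ k) / 2 by rewrite divr_gt0.
have [r r0 Hr] := holo_cont _ gH z _ L20.
have [|w [Dw zw]] := Dz (ball (z : Cplx R) r%:C).
  by apply: nbhsx_ballx; rewrite ltcR.
have wr : cmod (w - z) <= r.
  by move: zw; rewrite -ball_normE/= norm_cmod ltcR cmodBC => /ltW.
have := le_trans (Re_le_cmod _) (Hr w wr); rewrite cReB ler_norml => /andP[H _].
have := HD w Dw; lra.
Qed.

End Asymptotics.

Theorem theorem1p1 (R : realType) (k : nat) (p : {poly R[i]})
    (beta : Cplx R -> Cplx R) (th : nat -> R)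
    (hk : (1 <= k)%N) (hp : size p = k.+1)
    (beta_entire : entire beta)
    (beta_small : small_function beta (fun z => cexp p.[z]))
    (hth : critical_angles p th) :
  (forall j : nat, (1 <= j <= 2 * k)%N ->
     (forall theta : R, th j < theta < th j.+1 -> 0 < delta p theta) ->
     exists a : Cplx R, forall eps : R, 0 < eps ->
       le_exp_o k (subsector th j eps)
         (fun z => cmod (Hfun p beta z - a * cexp p.[z])))
  /\
  (forall j : nat, (1 <= j <= 2 * k)%N ->
     (forall theta : R, th j < theta < th j.+1 -> delta p theta < 0) ->
     forall a : Cplx R,
       le_exp_o k (closure (sector th j))
         (fun z => cmod (Hfun p beta z - a * cexp p.[z]))).
Proof.
have betaH := entire_holo _ beta_entire.
have growth := small_function_growth _ _ _ hp betaH beta_small.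
split=> j _ Hd.
  have [thj|thj] := leP (th j.+1) (th j).
    exists 0 => eps eps0 eta _; exists 0 => z [r [t [_ /andP[h1 h2] _]]].
    lra.
  (* The bisecting ray lies in every nonempty subsector, so [a] can be fixed before [eps]. *)
  pose t0 := (th j + th j.+1) / 2.
  have dt0 : 0 < delta p t0 by apply: Hd; rewrite /t0; apply/andP; split; lra.
  have [a Ha] := ray_limit _ _ _ hk hp betaH growth _ dt0.
  exists a => eps eps0 eta eta0.
  pose u := th j + eps; pose v := th j.+1 - eps.
  have [uv|vu] := leP u v; last first.
    exists 0 => z [r [t [_ /andP[h1 h2] _]]].
    by rewrite /u /v in vu; lra.
  have [tm tmI Hmin] := EVT_min uv (continuous_subspaceT (continuous_delta p)).
  pose c := delta p tm.
  have c0 : 0 < c.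
    by apply: Hd; move: tmI; rewrite in_itv/= /u /v => /andP[? ?]; apply/andP; split; lra.
  (* [eta / 6] makes 3 e <= eta / 2; the other half of [eta] absorbs the constants. *)
  pose e := Num.min (c / 8) (eta / 6).
  have e0 : 0 < e by rewrite lt_min !divr_gt0.
  have ec : 8 * e <= c by rewrite mulrC -ler_pdivlMr// ge_min lexx.
  have e6 : e <= eta / 6 by rewrite ge_min lexx orbT.
  have ut0v : u <= t0 <= v.
    by rewrite /t0 /u /v in uv *; apply/andP; split; lra.
  have [|C HC] := increasing_sector_bound _ _ _ hk hp betaH growth _ _ _ _ _ _ Ha ut0v c0 e0 ec.
    by move=> t tuv; apply: Hmin; rewrite in_itv.
  (* Taking |C| makes the exponential at least 1, so the additive 1 is absorbed as one more multiple
     of it. *)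
  have [r0 r01 Hr0] := expR_absorbs k (2 / c + 1) `|C| eta hk eta0.
  exists r0 => z [r [t [rge0 tI zE]]]; rewrite zE cmod_polar// => r0r.
  have r1 : 1 <= r by exact: le_trans r0r.
  apply: (le_trans _ (Hr0 _ r0r)).
  have -> : Hfun p beta (polar r t) - a * cexp p.[polar r t] =
      cexp p.[polar r t] * (cint0 (fun z => beta z * cexp (- p.[z])) (polar r t) - a).
    by rewrite /Hfun mulrBr [a * _]mulrC.
  apply: (le_trans (HC r t r1 tI)).
  have rk : 0 <= r ^+ k by rewrite exprn_ge0.
  have E1 : expR (3 * e * r ^+ k + C) <= expR (eta / 2 * r ^+ k + `|C|).
    rewrite ler_expR lerD ?ler_norm// ler_wpM2r//; lra.
  have E2 : 1 <= expR (eta / 2 * r ^+ k + `|C|).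
    by rewrite -[leLHS]expR0 ler_expR addr_ge0// mulr_ge0// divr_ge0// ltW.
  have c20 : 0 <= 2 / c by rewrite divr_ge0// ltW.
  have E3 := ler_wpM2l c20 E1.
  have E4 := mulr_ge0 rge0 (le_trans ler01 E2).
  move: E1 E2 E3 E4; set X := expR (eta / 2 * _ + _); set Y := expR _; move: (2 / c) => q.
  move=> E1 E2 E3 E4; rewrite !mulrDl mul1r; lra.
move=> a eta eta0; have e0 : 0 < eta / 6 by rewrite divr_gt0.
have [C HC] := decreasing_sector_bound _ _ _ hp betaH growth _ e0.
(* In the factor r + |a|, [r] comes from the length of the segment in the bound for [H] and |a| from
   the term [a * cexp p.[z]]. *)
have [r0 r01 Hr0] := expR_absorbs k (cmod a) C eta hk eta0.
exists r0 => z Dz zr; apply: (le_trans _ (Hr0 _ zr)).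
have Lz : complex.Re (lead_coef p * z ^+ k) <= 0.
  apply: Re_lead_closure_le0 Dz => w [r [t [rge0 tI ->]]].
  by rewrite Re_lead_polar// mulr_ge0_le0 ?exprn_ge0// ltW// Hd.
have [H1 H2] := HC z Lz.
have -> : eta / 2 = 3 * (eta / 6) by field.
apply: (le_trans (le_cmodB _ _)); rewrite mulrDl; apply: lerD; first exact: H2.
by rewrite cmodM; apply: ler_wpM2l; rewrite ?cmod_ge0.
Qed.
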